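(* Let $d\ge 2$. Let $\mathcal{H}_0$ be the hypothesis that samples are drawn i.i.d. from the uniform distribution on $\{0,\dots,d-1\}$, and let $\mathcal{H}_1$ be the hypothesis that samples are drawn i.i.d. from the distribution $p_U(x)=|\bra{x}U\ket{0}|^2$, $x\in\{0,\dots,d-1\}$, where $U$ is an unknown $d\times d$ Haar-random unitary (drawn once, the same for all samples). Then there exists a test based on $N=\mathcal{O}(\sqrt{d})$ independent samples that decides between $\mathcal{H}_0$ and $\mathcal{H}_1$ with success probability at least $2/3$.
   Context: $\{\ket{x}\}_{x=0}^{d-1}$ denotes the computational basis of $\mathbb{C}^d$. *)

(* Defs.v *)
From HB Require Import structures.
From mathcomp Require Import all_boot all_order all_algebra.
From mathcomp Require Import all_classical all_reals all_analysis.
From mathcomp Require Import complex.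
Set Implicit Arguments. Unset Strict Implicit. Unset Printing Implicit Defensive.
Import Order.TTheory GRing.Theory Num.Theory.
Local Open Scope ring_scope.
Local Open Scope classical_set_scope.

Definition adjmx (R : rcfType) (d : nat) (U : 'M[R[i]]_d) : 'M[R[i]]_d :=
  \matrix_(a, b) conjc (U b a).

(* U is unitary: U U^dagger = 1 (equivalently U^dagger U = 1, U square). *)
Definition unitary (R : rcfType) (d : nat) (U : 'M[R[i]]_d) : Prop :=
  U *m adjmx U = 1%:M.

(* Generators of the Borel sigma-algebra on C^(d x d) ~ R^(2 d^2):
   open half-spaces in the real and imaginary coordinates of each entry. *)
Definition mx_gen (R : rcfType) (d : nat) : set (set 'M[R[i]]_d) :=
  [set A | exists (a b : 'I_d) (c : R),
     A = [set M : 'M[R[i]]_d | complex.Re (M a b) < c] \/ A = [set M : 'M[R[i]]_d | complex.Im (M a b) < c]].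

Definition mx_borel (R : rcfType) (d : nat) : set (set 'M[R[i]]_d) :=
  <<s @mx_gen R d >>.

(* U : Omega -> M_d(C) is a Haar-random unitary on the probability space (Omega, P):
   it is a random variable (Borel measurable), takes values in U(d), and its law
   is left-invariant under every fixed unitary V (law of V U = law of U).  By
   uniqueness of the Haar measure this says exactly that U is Haar distributed. *)
Definition haar_random_unitary (R : realType) (d : nat)
    (d0 : measure_display) (Omega : measurableType d0) (P : probability Omega R)
    (U : Omega -> 'M[R[i]]_d) : Prop :=
  [/\ forall w, unitary (U w),
      forall A, @mx_borel R d A -> measurable (U @^-1` A)
    & forall V, unitary V -> forall A, @mx_borel R d A ->
        P (U @^-1` A) = P ((fun w => V *m U w) @^-1` A)].

Definition idx0 (d : nat) (hd : (0 < d)%N) : 'I_d := Ordinal hd.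

Definition pU (R : rcfType) (d : nat) (hd : (0 < d)%N) (U : 'M[R[i]]_d) (x : 'I_d) : R :=
  complex.Re (U x (idx0 hd)) ^+ 2 + complex.Im (U x (idx0 hd)) ^+ 2.

(* Main.v *)
Require Import Defs.
From HB Require Import structures.
From mathcomp Require Import all_boot all_order all_algebra.
From mathcomp Require Import all_classical all_reals all_analysis.
From mathcomp Require Import measurable_realfun complex.
From mathcomp Require Import ring lra.
Set Implicit Arguments. Unset Strict Implicit. Unset Printing Implicit Defensive.
Import Order.TTheory GRing.Theory Num.Theory.
Local Open Scope ring_scope.
Local Open Scope classical_set_scope.

Local Notation Re := complex.Re.
Local Notation Im := complex.Im.

(* For large d the test counts collisions between two batches of m ~ sqrt d
   samples.  Given the sampling distribution p, the number Z of collisions has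
   mean m^2 S2 and second moment
     m^2 S2 + 2 m^2 (m - 1) S3 + m^2 (m - 1)^2 S2^2,   where Sk = sum_x p(x)^k.
   S2 equals 1/d for the uniform distribution, and concentrates around 2/(d+1)
   for a Haar-random column, so Chebyshev's inequality separates the hypotheses.
   The moments of p_U come from invariance alone: SU(2) acting on coordinates
   x, y fixes r = p(x) + p(y) and rotates the Bloch vector, of length r, whose
   first component is s = p(x) - p(y).  Finitely many rotations already give
   E[r^j s^2] = E[r^(j+2)] / 3 and E[s^4] = E[r^4] / 5; together with
   sum_x p(x) = 1 these determine all the moments needed.

   For small d the spread of S2 is too large, but N may be any constant, and the
   test compares the counts of two symbols.  Among 7 suitable rotations at most
   2 can bring a given Bloch vector close to the plane s = 0, unless r is much
   smaller than 2/d, which the test also detects.  So by invariance p(x) and p(y)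
   are nearly equal with probability at most 2/7 < 1/3. *)

(** * Expectations over i.i.d. samples *)

Section IidExpectation.
Variables (R : realFieldType) (T : finType) (p : T -> R).

(** Expectation over [n] i.i.d. draws with weights [p]. Recursion on lists, instead of a sum over
    tuples, lets moments follow by induction and a sample be split by concatenation. *)
Fixpoint iidE n (f : seq T -> R) : R :=
  if n is n'.+1 then \sum_a p a * iidE n' (fun s => f (a :: s)) else f [::].

Lemma iidE_tuple n (f : seq T -> R) :
  \sum_(x : n.-tuple T) (\prod_(k < n) p (tnth x k)) * f x = iidE n f.
Proof.
elim: n f => [|n IHn] f /=.
  rewrite (big_pred1 [tuple]) => [|x]; last by rewrite [x]tuple0; apply/esym/eqP.
  by rewrite big_ord0 mul1r.
rewrite (reindex (fun at_ : T * n.-tuple T => [tuple of at_.1 :: at_.2])) /=; last first.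
  exists (fun x => (thead x, [tuple of behead x])) => [[a t] _ | x _] /=.
    by rewrite theadE; congr (_, _); apply: val_inj.
  by rewrite -tuple_eta.
rewrite -(pair_bigA _ (fun a (t : n.-tuple T) =>
  (\prod_(k < n.+1) p (tnth [tuple of a :: t] k)) * f (a :: t))) /=.
apply: eq_bigr => a _; rewrite -IHn mulr_sumr; apply: eq_bigr => t _.
rewrite big_ord_recl tnth0 mulrA; congr (_ * _ * _).
by apply: eq_bigr => k _; rewrite tnthS.
Qed.

Lemma eq_iidE n f g : f =1 g -> iidE n f = iidE n g.
Proof.
elim: n f g => [|n IHn] f g fg /=; first exact: fg.
by apply: eq_bigr => a _; congr (_ * _); apply: IHn => s; apply: fg.
Qed.

Lemma iidED n f g : iidE n (fun s => f s + g s) = iidE n f + iidE n g.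
Proof.
elim: n f g => [|n IHn] f g //=; rewrite -big_split /=.
by apply: eq_bigr => a _; rewrite IHn mulrDr.
Qed.

Lemma iidEZ n c f : iidE n (fun s => c * f s) = c * iidE n f.
Proof.
elim: n f => [|n IHn] f //=; rewrite mulr_sumr.
by apply: eq_bigr => a _; rewrite IHn mulrCA.
Qed.

Lemma iidE_sum n (I : finType) (F : I -> seq T -> R) :
  iidE n (fun s => \sum_i F i s) = \sum_i iidE n (F i).
Proof.
elim: n F => [|n IHn] F //=; rewrite exchange_big /=.
by apply: eq_bigr => a _; rewrite IHn mulr_sumr.
Qed.

Lemma iidE_cat m n f :
  iidE (m + n) f = iidE m (fun s => iidE n (fun t => f (s ++ t))).
Proof.
elim: m f => [|m IHm] f //=.
by apply: eq_bigr => a _; rewrite IHm.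
Qed.

Lemma eq_size_iidE n f g :
  (forall s, size s = n -> f s = g s) -> iidE n f = iidE n g.
Proof.
elim: n f g => [|n IHn] f g fg /=; first exact: fg.
by apply: eq_bigr => a _; congr (_ * _); apply: IHn => s ss; apply: fg => /=; rewrite ss.
Qed.

Hypothesis p_ge0 : forall a, 0 <= p a.

Lemma le_iidE n f g : (forall s, f s <= g s) -> iidE n f <= iidE n g.
Proof.
elim: n f g => [|n IHn] f g fg /=; first exact: fg.
by apply: ler_sum => a _; apply: ler_wpM2l => //; apply: IHn => s; apply: fg.
Qed.

Hypothesis p_sum1 : \sum_a p a = 1.

Lemma iidE_cst n c : iidE n (fun=> c) = c.
Proof. by elim: n => [|n IHn] //=; rewrite IHn -mulr_suml p_sum1 mul1r. Qed.

Lemma iidE_ge0 n f : (forall s, 0 <= f s) -> 0 <= iidE n f.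
Proof. by move=> f0; rewrite -[leLHS](iidE_cst n); apply: le_iidE. Qed.

Lemma iidE_neg n (b : pred (seq T)) :
  iidE n (fun s => (~~ b s)%:R) = 1 - iidE n (fun s => (b s)%:R).
Proof.
rewrite -[X in X - _](iidE_cst n) -mulN1r -iidEZ -iidED; apply: eq_iidE => s.
by case: (b s); rewrite /=; ring.
Qed.

Definition mean (g : T -> R) := \sum_a p a * g a.
Definition lsum (g : T -> R) (s : seq T) := \sum_(a <- s) g a.

Lemma iidE_lsum n g : iidE n (lsum g) = n%:R * mean g.
Proof.
elim: n => [|n IHn] /=; first by rewrite /lsum big_nil mul0r.
transitivity (\sum_a (p a * g a + p a * (n%:R * mean g))).
  apply: eq_bigr => a _; rewrite -mulrDr -IHn -[X in _ = _ * (X + _)](iidE_cst n) -iidED.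
  by congr (_ * _); apply: eq_iidE => s; rewrite /lsum big_cons.
by rewrite big_split /= -mulr_suml p_sum1 -/(mean g) -natr1; ring.
Qed.

(** In the product of the two sums, the n diagonal pairs give the mean of the product, and the n (n
    - 1) other pairs are independent. *)
Lemma iidE_lsumM n g h : iidE n (fun s => lsum g s * lsum h s) =
  n%:R * mean (fun a => g a * h a) + n%:R * (n%:R - 1) * (mean g * mean h).
Proof.
elim: n => [|n IHn] /=; first by rewrite /lsum !big_nil !mul0r addr0.
set K := _ + _ in IHn.
transitivity (\sum_a (p a * (g a * h a) + (p a * g a * (n%:R * mean h)
   + (p a * h a * (n%:R * mean g) + p a * K)))).
  apply: eq_bigr => a _; rewrite -IHn -!iidE_lsum -!mulrA -!mulrDr; congr (_ * _).
  rewrite -[X in _ = X + _](iidE_cst n) -!iidEZ -!iidED.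
  by apply: eq_iidE => s; rewrite /lsum !big_cons; ring.
rewrite !big_split /= -!mulr_suml p_sum1 -/(mean g) -/(mean h) -/(mean (fun a => g a * h a)).
by rewrite /K -natr1; ring.
Qed.

Lemma lsum_variance n g : iidE n (fun s => (lsum g s - n%:R * mean g) ^+ 2) =
  n%:R * (mean (fun a => g a ^+ 2) - mean g ^+ 2).
Proof.
transitivity (iidE n (fun s => lsum g s * lsum g s) +
  ((- (2 * n%:R * mean g)) * iidE n (lsum g) + iidE n (fun=> (n%:R * mean g) ^+ 2))).
  by rewrite -iidEZ -!iidED; apply: eq_iidE => s; ring.
rewrite iidE_lsumM iidE_lsum iidE_cst.
have -> : mean (fun a => g a * g a) = mean (fun a => g a ^+ 2) by [].
by ring.
Qed.

Lemma chebyshev_iidE n f (b : pred (seq T)) (c D : R) : 0 < D ->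
  (forall s, b s -> D <= `|f s - c|) ->
  iidE n (fun s => (b s)%:R) <= iidE n (fun s => (f s - c) ^+ 2) / D ^+ 2.
Proof.
move=> D0 bD; rewrite mulrC -iidEZ; apply: le_iidE => s.
have D20 : 0 < D ^+ 2 by rewrite exprn_gt0.
have [/bD h|_] := boolP (b s); last by rewrite mulr0n mulr_ge0 ?invr_ge0 ?sqr_ge0.
rewrite mulrC ler_pdivlMr // mul1r -[leRHS]real_normK ?num_real //.
by apply: lerXn2r; rewrite ?nnegrE // ltW.
Qed.

(** Counts the pairs of equal samples, one from each batch. For a fixed batch [s] it is a sum of
    i.i.d. terms over [t]. *)
Definition collisions (s t : seq T) : R := lsum (fun b => (count_mem b s)%:R) t.

Lemma count_lsum b s : (count_mem b s)%:R = lsum (fun a => (a == b)%:R) s.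
Proof. by rewrite /lsum -sum1_count natr_sum big_mkcond; apply: eq_bigr => a _ /=; case: eqP. Qed.

Lemma mean_eq b : mean (fun a => (a == b)%:R) = p b.
Proof.
rewrite /mean (bigD1 b) //= eqxx mulr1 big1 ?addr0 // => a /negPf ->.
exact: mulr0.
Qed.

Definition psum k := \sum_a p a ^+ k.

Lemma mean_count s : mean (fun b => (count_mem b s)%:R) = lsum p s.
Proof.
rewrite /mean; under eq_bigr do rewrite count_lsum /lsum mulr_sumr.
rewrite exchange_big /=; apply: eq_bigr => a _.
by rewrite -[RHS]mean_eq; apply: eq_bigr => b _; rewrite eq_sym.
Qed.

Lemma collisions_mean m : iidE m (fun s => iidE m (collisions s)) = m%:R ^+ 2 * psum 2.
Proof.
under eq_iidE do rewrite /collisions iidE_lsum mean_count.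
by rewrite iidEZ iidE_lsum mulrA.
Qed.

(** Averaging over [t] first leaves squared counts and the square of [lsum p s], which are again
    second-order expressions in linear statistics of [s]. *)
Lemma collisions_sqr m : iidE m (fun s => iidE m (fun t => collisions s t ^+ 2)) =
  m%:R ^+ 2 * psum 2 + 2 * m%:R ^+ 2 * (m%:R - 1) * psum 3
  + m%:R ^+ 2 * (m%:R - 1) ^+ 2 * psum 2 ^+ 2.
Proof.
transitivity (iidE m (fun s => m%:R * (\sum_b p b * (count_mem b s)%:R ^+ 2)
    + m%:R * (m%:R - 1) * (lsum p s * lsum p s))).
  by apply: eq_iidE => s; rewrite iidE_lsumM !mean_count.
rewrite iidED !iidEZ iidE_lsumM iidE_sum.
have -> : \sum_b iidE m (fun s => p b * (count_mem b s)%:R ^+ 2) =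
    m%:R * psum 2 + m%:R * (m%:R - 1) * psum 3.
  rewrite /psum !mulr_sumr -big_split /=; apply: eq_bigr => b _; rewrite iidEZ.
  under eq_iidE do rewrite expr2 count_lsum.
  rewrite iidE_lsumM mean_eq.
  have -> : mean (fun a => (a == b)%:R * (a == b)%:R) = p b.
    by rewrite -[RHS]mean_eq; apply: eq_bigr => a _; case: (a == b); rewrite ?mulr1 ?mulr0.
  by ring.
have -> : mean (fun a => p a * p a) = psum 3 by apply: eq_bigr => a _; ring.
have -> : mean p = psum 2 by [].
by ring.
Qed.

End IidExpectation.

(** * Unitary matrices and the Bloch vector *)

Section Complex.
Variable R : rcfType.
Implicit Types z w : R[i].

Lemma complex_ReD z w : Re (z + w) = Re z + Re w.
Proof. by case: z w => [? ?] []. Qed.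
Lemma complex_ImD z w : Im (z + w) = Im z + Im w.
Proof. by case: z w => [? ?] []. Qed.
Lemma complex_ReM z w : Re (z * w) = Re z * Re w - Im z * Im w.
Proof. by case: z w => [? ?] []. Qed.
Lemma complex_ImM z w : Im (z * w) = Re z * Im w + Im z * Re w.
Proof. by case: z w => [? ?] []. Qed.
Lemma complex_Reconj z : Re (conjc z) = Re z.
Proof. by case: z. Qed.
Lemma complex_Imconj z : Im (conjc z) = - Im z.
Proof. by case: z. Qed.
Lemma complex_Re_sum (I : finType) (F : I -> R[i]) : Re (\sum_i F i) = \sum_i Re (F i).
Proof. by apply: (big_morph _ complex_ReD). Qed.
Lemma complex_Im_sum (I : finType) (F : I -> R[i]) : Im (\sum_i F i) = \sum_i Im (F i).
Proof. by apply: (big_morph _ complex_ImD). Qed.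
Lemma complex_ext z w : Re z = Re w -> Im z = Im w -> z = w.
Proof. by case: z w => [? ?] [? ?] /= -> ->. Qed.

Lemma unitary_row d (U : 'M[R[i]]_d) a : unitary U ->
  \sum_b (Re (U a b) ^+ 2 + Im (U a b) ^+ 2) = 1.
Proof.
move=> /matrixP /(_ a a); rewrite !mxE eqxx => /(congr1 (@complex.Re R)).
rewrite complex_Re_sum /= => <-; apply: eq_bigr => b _.
by rewrite mxE complex_ReM complex_Reconj complex_Imconj; ring.
Qed.

Lemma pU_sum1 d (hd : (0 < d)%N) (U : 'M[R[i]]_d) : unitary U -> \sum_x pU hd U x = 1.
Proof.
move=> /mulmx1C /matrixP /(_ (idx0 hd) (idx0 hd)); rewrite !mxE eqxx.
move=> /(congr1 (@complex.Re R)); rewrite complex_Re_sum /= => <-.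
apply: eq_bigr => b _.
by rewrite mxE complex_ReM complex_Reconj complex_Imconj /pU; ring.
Qed.

Lemma pU_ge0 d (hd : (0 < d)%N) (U : 'M[R[i]]_d) x : 0 <= pU hd U x.
Proof. by rewrite addr_ge0 ?sqr_ge0. Qed.

Lemma unitary_ReIm_le1 d (U : 'M[R[i]]_d) a b : unitary U ->
  `|Re (U a b)| <= 1 /\ `|Im (U a b)| <= 1.
Proof.
move=> /(unitary_row a); rewrite (bigD1 b) //=.
set s := (X in _ + X = _) => hs.
have s0 : 0 <= s by apply: sumr_ge0 => c _; rewrite addr_ge0 ?sqr_ge0.
have := sqr_ge0 (Re (U a b)); have := sqr_ge0 (Im (U a b)).
by split; rewrite ler_norml; apply/andP; split; nra.
Qed.

End Complex.

Section SpecialUnitary.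
Variables (R : rcfType) (d : nat) (x y : 'I_d) (a b : R[i]).

(* The element [[a, b], [- b^*, a^*]] of SU(2) acting on the coordinates x and y. *)
Definition su2 : 'M[R[i]]_d := \matrix_(i, j)
  if i == x then (if j == x then a else if j == y then b else 0)
  else if i == y then (if j == x then - conjc b else if j == y then conjc a else 0)
  else (i == j)%:R.

Hypothesis xy : y != x.

Lemma su2_mulE n (M : 'M[R[i]]_(d, n)) i j : (su2 *m M) i j =
  if i == x then a * M x j + b * M y j
  else if i == y then - conjc b * M x j + conjc a * M y j else M i j.
Proof.
rewrite mxE.
have two (f g : R[i]) : \sum_l (if l == x then f else if l == y then g else 0) * M l j =
    f * M x j + g * M y j.
  rewrite (bigD1 x) //= eqxx (bigD1 y) //= (negPf xy) eqxx big1 ?addr0 //.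
  by move=> l /andP[/negPf -> /negPf ->]; rewrite mul0r.
case: ifP => ix; first by rewrite -two; apply: eq_bigr => l _; rewrite !mxE ix.
case: ifP => iy; first by rewrite -two; apply: eq_bigr => l _; rewrite !mxE ix iy.
rewrite (bigD1 i) //= mxE ix iy eqxx mul1r big1 ?addr0 // => l li.
by rewrite mxE ix iy eq_sym (negPf li) mul0r.
Qed.

Hypothesis ab1 : Re a ^+ 2 + Im a ^+ 2 + Re b ^+ 2 + Im b ^+ 2 = 1.

Lemma su2_unitary : unitary su2.
Proof.
apply/matrixP => i j; rewrite su2_mulE !mxE.
have yx : (x == y) = false by rewrite eq_sym (negPf xy).
have [jx|jx] := eqVneq j x; [subst j|have [jy|jy] := eqVneq j y; [subst j|]];
  have [ix|ix] := eqVneq i x; do ?[subst i];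
  try (have [iy|iy] := eqVneq i y; do ?[subst i]);
  rewrite ?eqxx ?yx ?(negPf xy) ?(negPf ix) ?(negPf iy) ?(negPf jx) ?(negPf jy) //;
  do ?[by rewrite ?(eq_sym x) ?(eq_sym y) ?(negPf jx) ?(negPf jy) conjc0 ?mulr0 addr0].
all: rewrite ?conjc0 ?conjc_nat 1?eq_sym //.
all: by apply: complex_ext; move: ab1; case: a => a1 a2; case: b => b1 b2 /= ?; lra.
Qed.

(* Bloch coordinates of (u x, u y): bloch2 and bloch3 are twice the real and
   imaginary parts of u x * (u y)^*, and bloch0 is the length. *)
Definition bloch0 (u : 'I_d -> R[i]) := Re (u x) ^+ 2 + Im (u x) ^+ 2 + (Re (u y) ^+ 2 + Im (u y) ^+ 2).
Definition bloch1 (u : 'I_d -> R[i]) := Re (u x) ^+ 2 + Im (u x) ^+ 2 - (Re (u y) ^+ 2 + Im (u y) ^+ 2).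
Definition bloch2 (u : 'I_d -> R[i]) := 2 * (Re (u x) * Re (u y) + Im (u x) * Im (u y)).
Definition bloch3 (u : 'I_d -> R[i]) := 2 * (Im (u x) * Re (u y) - Re (u x) * Im (u y)).

Lemma bloch_norm u : bloch1 u ^+ 2 + bloch2 u ^+ 2 + bloch3 u ^+ 2 = bloch0 u ^+ 2.
Proof. by rewrite /bloch0 /bloch1 /bloch2 /bloch3; ring. Qed.

Lemma su2_bloch0 n (M : 'M[R[i]]_(d, n)) j :
  bloch0 (fun i => (su2 *m M) i j) = bloch0 (fun i => M i j).
Proof.
rewrite /bloch0 !su2_mulE eqxx (negPf xy) eqxx.
rewrite -[RHS]mul1r -ab1.
case: (M x j) (M y j) a b => [x1 x2] [y1 y2] [a1 a2] [b1 b2] /=; ring.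
Qed.

(** This and the next two lemmas give the rows of the rotation in SO(3) that the SU(2) matrix
    induces on the Bloch vector. *)
Lemma su2_bloch1 n (M : 'M[R[i]]_(d, n)) j :
  bloch1 (fun i => (su2 *m M) i j) =
    (Re a ^+ 2 + Im a ^+ 2 - Re b ^+ 2 - Im b ^+ 2) * bloch1 (fun i => M i j)
    + 2 * (Re a * Re b + Im a * Im b) * bloch2 (fun i => M i j)
    - 2 * (Im a * Re b - Re a * Im b) * bloch3 (fun i => M i j).
Proof.
rewrite /bloch1 /bloch2 /bloch3 !su2_mulE eqxx (negPf xy) eqxx.
case: (M x j) (M y j) a b => [x1 x2] [y1 y2] [a1 a2] [b1 b2] /=; ring.
Qed.

Lemma su2_bloch2 n (M : 'M[R[i]]_(d, n)) j :
  bloch2 (fun i => (su2 *m M) i j) =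
    - 2 * (Re a * Re b - Im a * Im b) * bloch1 (fun i => M i j)
    + (Re a ^+ 2 - Im a ^+ 2 - Re b ^+ 2 + Im b ^+ 2) * bloch2 (fun i => M i j)
    - 2 * (Re a * Im a + Re b * Im b) * bloch3 (fun i => M i j).
Proof.
rewrite /bloch1 /bloch2 /bloch3 !su2_mulE eqxx (negPf xy) eqxx.
case: (M x j) (M y j) a b => [x1 x2] [y1 y2] [a1 a2] [b1 b2] /=; ring.
Qed.

Lemma su2_bloch3 n (M : 'M[R[i]]_(d, n)) j :
  bloch3 (fun i => (su2 *m M) i j) =
    - 2 * (Re a * Im b + Im a * Re b) * bloch1 (fun i => M i j)
    + 2 * (Re a * Im a - Re b * Im b) * bloch2 (fun i => M i j)
    + (Re a ^+ 2 - Im a ^+ 2 + Re b ^+ 2 - Im b ^+ 2) * bloch3 (fun i => M i j).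
Proof.
rewrite /bloch1 /bloch2 /bloch3 !su2_mulE eqxx (negPf xy) eqxx.
case: (M x j) (M y j) a b => [x1 x2] [y1 y2] [a1 a2] [b1 b2] /=; ring.
Qed.


End SpecialUnitary.

(** * Expectations under the Haar measure *)

HB.instance Definition _ (R : realType) := isPointed.Build R[i] 0.

Section BoundedBorel.
Variables (R : realType) (d : nat).
Local Notation MT := (g_sigma_algebraType (@mx_gen R d)).
Implicit Types h : 'M[R[i]]_d -> R.

Lemma measurable_mxRe (a b : 'I_d) :
  measurable_fun [set: MT] (fun M : MT => Re (M a b)).
Proof.
move=> mD; apply: (measurability _ (RGenInftyO.measurableE R)) => //.
move=> _ [_ [c ->] <-]; rewrite setTI; apply: sub_sigma_algebra.
exists a, b, c; left; apply/seteqP; split => M /=; by rewrite in_itv.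
Qed.

Lemma measurable_mxIm (a b : 'I_d) :
  measurable_fun [set: MT] (fun M : MT => Im (M a b)).
Proof.
move=> mD; apply: (measurability _ (RGenInftyO.measurableE R)) => //.
move=> _ [_ [c ->] <-]; rewrite setTI; apply: sub_sigma_algebra.
exists a, b, c; right; apply/seteqP; split => M /=; by rewrite in_itv.
Qed.

Lemma measurable_mulmxl (V : 'M[R[i]]_d) : measurable_fun [set: MT] (fun M : MT => V *m M : MT).
Proof.
have mRe a b : measurable_fun [set: MT] (fun M : MT => Re ((V *m M) a b)).
  rewrite (_ : (fun _ => _) = fun M : MT => \sum_(j < d)
      (Re (V a j) * Re (M j b) - Im (V a j) * Im (M j b))); last first.
    by apply/funext => M; rewrite mxE complex_Re_sum; apply: eq_bigr => j _; rewrite complex_ReM.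
  apply: measurable_sum => j; apply: measurable_funB;
  by apply: measurable_funM; [exact: measurable_cst | exact: measurable_mxRe || exact: measurable_mxIm].
have mIm a b : measurable_fun [set: MT] (fun M : MT => Im ((V *m M) a b)).
  rewrite (_ : (fun _ => _) = fun M : MT => \sum_(j < d)
      (Re (V a j) * Im (M j b) + Im (V a j) * Re (M j b))); last first.
    by apply/funext => M; rewrite mxE complex_Im_sum; apply: eq_bigr => j _; rewrite complex_ImM.
  apply: measurable_sum => j; apply: measurable_funD;
  by apply: measurable_funM; [exact: measurable_cst | exact: measurable_mxRe || exact: measurable_mxIm].
apply: (@measurability _ _ MT MT setT _ (@mx_gen R d)) => //.
move=> _ [_ [a [b [c []]]] -> <-].
  rewrite (_ : _ `&` _ = [set: MT] `&` (fun M : MT => Re ((V *m M) a b)) @^-1` `]-oo, c[).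
    by apply: mRe => //; exact: measurable_itv.
  by apply/seteqP; split => M /=; rewrite in_itv.
rewrite (_ : _ `&` _ = [set: MT] `&` (fun M : MT => Im ((V *m M) a b)) @^-1` `]-oo, c[).
  by apply: mIm => //; exact: measurable_itv.
by apply/seteqP; split => M /=; rewrite in_itv.
Qed.

(** Boundedness is asked on unitary matrices only: polynomials in the entries then qualify, and
    every member is integrable against a law carried by the unitary group. *)
Definition bounded_borel h :=
  measurable_fun [set: MT] (h : MT -> R) /\
  exists B, forall M, unitary M -> `|h M| <= B.

Lemma bounded_borel_Re a b : bounded_borel (fun M => Re (M a b)).
Proof.
split; first exact: measurable_mxRe.
by exists 1 => M /(unitary_ReIm_le1 a b) [].
Qed.

Lemma bounded_borel_Im a b : bounded_borel (fun M => Im (M a b)).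
Proof.
split; first exact: measurable_mxIm.
by exists 1 => M /(unitary_ReIm_le1 a b) [].
Qed.

Lemma bounded_borel_cst c : bounded_borel (fun=> c).
Proof. by split; [exact: measurable_cst | exists `|c|]. Qed.

Lemma bounded_borelD h1 h2 : bounded_borel h1 -> bounded_borel h2 ->
  bounded_borel (fun M => h1 M + h2 M).
Proof.
move=> [m1 [B1 hB1]] [m2 [B2 hB2]]; split; first exact: measurable_funD.
by exists (B1 + B2) => M uM; rewrite (le_trans (ler_normD _ _))// lerD ?hB1 ?hB2.
Qed.

Lemma bounded_borelM h1 h2 : bounded_borel h1 -> bounded_borel h2 ->
  bounded_borel (fun M => h1 M * h2 M).
Proof.
move=> [m1 [B1 hB1]] [m2 [B2 hB2]]; split; first exact: measurable_funM.
by exists (B1 * B2) => M uM; rewrite normrM ler_pM ?hB1 ?hB2.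
Qed.

Lemma bounded_borelN h : bounded_borel h -> bounded_borel (fun M => - h M).
Proof.
move=> [m1 [B1 hB1]]; split; first exact: measurable_funN.
by exists B1 => M uM; rewrite normrN hB1.
Qed.

Lemma bounded_borelX h n : bounded_borel h -> bounded_borel (fun M => h M ^+ n).
Proof.
move=> hh; elim: n => [|n IHn]; first exact: bounded_borel_cst.
rewrite (_ : (fun _ => _) = fun M => h M * h M ^+ n).
  exact: bounded_borelM.
by apply/funext => M; rewrite exprS.
Qed.

Lemma bounded_borel_sum (I : Type) (s : seq I) (Q : pred I) (F : I -> 'M[R[i]]_d -> R) :
  (forall i, bounded_borel (F i)) -> bounded_borel (fun M => \sum_(i <- s | Q i) F i M).
Proof.
move=> hF; elim: s => [|i s IHs].
  rewrite (_ : (fun _ => _) = fun=> 0); first exact: bounded_borel_cst.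
  by apply/funext => M; rewrite big_nil.
rewrite (_ : (fun _ => _) =
    fun M => (if Q i then F i M else 0) + \sum_(i <- s | Q i) F i M).
  apply: bounded_borelD => //; case: (Q i) => //; exact: bounded_borel_cst.
by apply/funext => M; rewrite big_cons; case: (Q i); rewrite ?add0r.
Qed.

Lemma bounded_borel_prod (I : Type) (s : seq I) (Q : pred I) (F : I -> 'M[R[i]]_d -> R) :
  (forall i, bounded_borel (F i)) -> bounded_borel (fun M => \prod_(i <- s | Q i) F i M).
Proof.
move=> hF; elim: s => [|i s IHs].
  rewrite (_ : (fun _ => _) = fun=> 1); first exact: bounded_borel_cst.
  by apply/funext => M; rewrite big_nil.
rewrite (_ : (fun _ => _) =
    fun M => (if Q i then F i M else 1) * \prod_(i <- s | Q i) F i M).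
  apply: bounded_borelM => //; case: (Q i) => //; exact: bounded_borel_cst.
by apply/funext => M; rewrite big_cons; case: (Q i); rewrite ?mul1r.
Qed.

Lemma bounded_borel_pU (hd : (0 < d)%N) x : bounded_borel (fun M => pU hd M x).
Proof.
apply: bounded_borelD; apply: bounded_borelX;
  [exact: bounded_borel_Re | exact: bounded_borel_Im].
Qed.

Lemma unitaryM (V W : 'M[R[i]]_d) : unitary V -> unitary W -> unitary (V *m W).
Proof.
have adjM : adjmx (V *m W) = adjmx W *m adjmx V.
  apply/matrixP => i j; rewrite !mxE rmorph_sum; apply: eq_bigr => k _.
  by rewrite !mxE rmorphM mulrC.
by rewrite /unitary adjM => hV hW; rewrite mulmxA -(mulmxA V) hW mulmx1.
Qed.

Lemma bounded_borel_mulmxl (V : 'M[R[i]]_d) h : unitary V -> bounded_borel h ->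
  bounded_borel (fun M => h (V *m M)).
Proof.
move=> uV [mh [B hB]]; split.
  exact: (measurableT_comp mh (measurable_mulmxl V)).
by exists B => M uM; apply: hB; exact: unitaryM.
Qed.

End BoundedBorel.

Section HaarExpectation.
Variables (R : realType) (d : nat) (d0 : measure_display) (Omega : measurableType d0).
Variables (P : probability Omega R) (U : Omega -> 'M[R[i]]_d).
Hypothesis HU : haar_random_unitary P U.
Local Notation MT := (g_sigma_algebraType (@mx_gen R d)).
Implicit Types h : 'M[R[i]]_d -> R.

Definition haarE h : R := Rintegral P setT (fun w => h (U w)).

Let mU : measurable_fun [set: Omega] (U : Omega -> MT).
Proof. by case: HU => _ h _ _ A mA; rewrite setTI; apply: h. Qed.

Lemma haar_integrable h : bounded_borel h ->
  P.-integrable setT (EFin \o (fun w => h (U w))).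
Proof.
case: HU => uU _ _ [mh [B hB]]; apply: measurable_bounded_integrable => //.
- by apply: (@le_lt_trans _ _ 1%E); [exact: probability_le1 | exact: ltry].
- exact: (measurableT_comp mh mU).
exists B; split; first exact: num_real.
by move=> x Bx w _; apply: (le_trans (hB _ (uU w))); exact: ltW.
Qed.

Lemma haar_integralE h : bounded_borel h ->
  (\int[P]_w (h (U w))%:E)%E = (haarE h)%:E.
Proof.
move=> hh; rewrite /haarE /Rintegral fineK //.
exact: (integrable_fin_num _ (haar_integrable hh)).
Qed.

Lemma haarED h1 h2 : bounded_borel h1 -> bounded_borel h2 ->
  haarE (fun M => h1 M + h2 M) = haarE h1 + haarE h2.
Proof. by move=> *; rewrite /haarE RintegralD//; exact: haar_integrable. Qed.

Lemma haarEZ c h : bounded_borel h -> haarE (fun M => c * h M) = c * haarE h.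
Proof. by move=> *; rewrite /haarE RintegralZl//; exact: haar_integrable. Qed.

Lemma haarE_cst c : haarE (fun=> c) = c.
Proof.
by rewrite /haarE Rintegral_cst// [X in fine X](_ : _ = 1%E) ?mulr1//; exact: probability_setT.
Qed.

Lemma haarE_le h1 h2 : bounded_borel h1 -> bounded_borel h2 ->
  (forall M, unitary M -> h1 M <= h2 M) -> haarE h1 <= haarE h2.
Proof.
move=> b1 b2 h12; apply: le_Rintegral => //; try exact: haar_integrable.
by move=> w _; apply: h12; case: HU.
Qed.

Lemma haarE_eq h1 h2 : (forall M, unitary M -> h1 M = h2 M) -> haarE h1 = haarE h2.
Proof.
by move=> h12; apply: eq_Rintegral => w _; apply: h12; case: HU.
Qed.

Lemma haarE_sum (I : Type) (s : seq I) (F : I -> 'M[R[i]]_d -> R) :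
  (forall i, bounded_borel (F i)) ->
  haarE (fun M => \sum_(i <- s) F i M) = \sum_(i <- s) haarE (F i).
Proof.
move=> hF; elim: s => [|i s IHs].
  by rewrite big_nil -[RHS](haarE_cst); apply: haarE_eq => M _; rewrite big_nil.
rewrite big_cons -IHs -haarED //; last exact: bounded_borel_sum.
by apply: haarE_eq => M _; rewrite big_cons.
Qed.

(** Both sides integrate [h] against pushforwards of [P], along [U] and along [V *m U]; left
    invariance makes these laws agree on Borel sets. *)
Lemma haarE_invariant V h : unitary V -> bounded_borel h ->
  haarE h = haarE (fun M => h (V *m M)).
Proof.
move=> uV hh; have [uU _ inv] := HU.
have mVU : measurable_fun [set: Omega] ((fun w => V *m U w) : Omega -> MT).
  exact: (measurableT_comp (measurable_mulmxl V) mU).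
have mh : measurable_fun [set: MT] (EFin \o (h : MT -> R)).
  by apply/measurable_EFinP; case: hh.
have iVU := haar_integrable (bounded_borel_mulmxl uV hh).
have iU := haar_integrable hh.
rewrite /haarE /Rintegral; congr fine.
rewrite -[LHS](integral_pushforward mU mh iU measurableT).
rewrite -[RHS](integral_pushforward mVU mh iVU measurableT).
by apply: eq_measure_integral => A mA _; apply: inv.
Qed.

End HaarExpectation.

Ltac bounded_borel := repeat first
  [ exact: bounded_borel_pU | exact: bounded_borel_Re | exact: bounded_borel_Im
  | exact: bounded_borel_cst | assumption
  | apply: bounded_borelX | apply: bounded_borelM | apply: bounded_borelN
  | apply: bounded_borelD | (apply: bounded_borel_sum; move=> ?) ].

(** * Moments of the output distribution from rotation invariance *)

Section HaarMoments.
Variables (R : realType) (d : nat) (d0 : measure_display) (Omega : measurableType d0).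
Variables (P : probability Omega R) (U : Omega -> 'M[R[i]]_d).
Hypothesis HU : haar_random_unitary P U.
Variable hd : (0 < d)%N.
Local Notation E := (haarE P U).
Local Notation p := (pU hd).

Section Pair.
Variables (x y : 'I_d).
Hypothesis xy : y != x.
Local Notation r M := (bloch0 x y (fun i => M i (idx0 hd))).
Local Notation s1 M := (bloch1 x y (fun i => M i (idx0 hd))).
Local Notation s2 M := (bloch2 x y (fun i => M i (idx0 hd))).
Local Notation s3 M := (bloch3 x y (fun i => M i (idx0 hd))).

Lemma bounded_borel_bloch0 : bounded_borel (fun M : 'M[R[i]]_d => r M).
Proof. by rewrite /bloch0; bounded_borel. Qed.
Lemma bounded_borel_bloch1 : bounded_borel (fun M : 'M[R[i]]_d => s1 M).
Proof. by rewrite /bloch1; bounded_borel. Qed.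
Lemma bounded_borel_bloch2 : bounded_borel (fun M : 'M[R[i]]_d => s2 M).
Proof. by rewrite /bloch2; bounded_borel. Qed.
Lemma bounded_borel_bloch3 : bounded_borel (fun M : 'M[R[i]]_d => s3 M).
Proof. by rewrite /bloch3; bounded_borel. Qed.
Hint Resolve bounded_borel_bloch0 bounded_borel_bloch1 bounded_borel_bloch2
  bounded_borel_bloch3 : core.
Ltac bb := repeat first [done | bounded_borel].

(* With a = b = (1 + i) / 2 the Bloch vector (s1, s2, s3) becomes (s2, - s3, - s1). *)
Lemma haar_bloch_cycle (F : R -> R -> R -> R -> R) :
  bounded_borel (fun M => F (r M) (s1 M ^+ 2) (s2 M ^+ 2) (s3 M ^+ 2)) ->
  E (fun M => F (r M) (s1 M ^+ 2) (s2 M ^+ 2) (s3 M ^+ 2)) =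
  E (fun M => F (r M) (s2 M ^+ 2) (s3 M ^+ 2) (s1 M ^+ 2)).
Proof.
set a : R[i] := Complex (1 / 2) (1 / 2) => hF.
have ab1 : Re a ^+ 2 + Im a ^+ 2 + Re a ^+ 2 + Im a ^+ 2 = 1 by rewrite /=; field.
rewrite (haarE_invariant HU (su2_unitary xy ab1) hF).
apply: (haarE_eq HU) => M _.
rewrite (su2_bloch0 xy ab1) (su2_bloch1 a a xy) (su2_bloch2 a a xy) (su2_bloch3 a a xy) /=.
by congr (F _ _ _ _); field.
Qed.

(** With a = 0 and b = 1 the matrix swaps the moduli of coordinates x and y: the Bloch length is
    fixed and its first component negated. *)
Lemma haar_bloch_flip (F : R -> R -> R) : bounded_borel (fun M => F (r M) (s1 M)) ->
  E (fun M => F (r M) (s1 M)) = E (fun M => F (r M) (- s1 M)).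
Proof.
set a : R[i] := Complex 0 0; set b : R[i] := Complex 1 0 => hF.
have ab1 : Re a ^+ 2 + Im a ^+ 2 + Re b ^+ 2 + Im b ^+ 2 = 1 by rewrite /=; ring.
rewrite (haarE_invariant HU (su2_unitary xy ab1) hF).
apply: (haarE_eq HU) => M _; rewrite (su2_bloch0 xy ab1) (su2_bloch1 a b xy) /=.
by congr (F _ _); ring.
Qed.

(** The half-angle entries 4/5 and 3/5 give a rational rotation mixing s1 and s2, with cosine 7/25
    and sine 24/25; the sign [e] chooses its direction. *)
Lemma haar_bloch_rotate (e : R) : e ^+ 2 = 1 ->
  E (fun M => s1 M ^+ 4) = E (fun M => (7 / 25 * s1 M + e * (24 / 25) * s2 M) ^+ 4).
Proof.
move=> e1; set a : R[i] := Complex (4 / 5) 0; set b : R[i] := Complex (e * (3 / 5)) 0.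
have ab1 : Re a ^+ 2 + Im a ^+ 2 + Re b ^+ 2 + Im b ^+ 2 = 1.
  by rewrite /=; lra.
rewrite (haarE_invariant HU (su2_unitary xy ab1)); last by bb.
apply: (haarE_eq HU) => M _; rewrite (su2_bloch1 a b xy) /=; congr (_ ^+ 4).
have -> : (4 / 5) ^+ 2 + 0 ^+ 2 - (e * (3 / 5)) ^+ 2 - 0 ^+ 2 = 7 / 25 :> R by lra.
by field.
Qed.

Lemma haar_bloch1_sqr j : E (fun M => r M ^+ j * s1 M ^+ 2) = E (fun M => r M ^+ j.+2) / 3.
Proof.
have c1 := @haar_bloch_cycle (fun r s _ _ => r ^+ j * s).
have c2 := @haar_bloch_cycle (fun r _ s _ => r ^+ j * s).
have : E (fun M => r M ^+ j.+2) = E (fun M => r M ^+ j * s1 M ^+ 2)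
    + (E (fun M => r M ^+ j * s2 M ^+ 2) + E (fun M => r M ^+ j * s3 M ^+ 2)).
  rewrite -!(haarED HU); try by bb.
  by apply: (haarE_eq HU) => M _; rewrite -!mulrDr addrA bloch_norm -exprD addn2.
rewrite -c2; last by bb.
rewrite -c1; last by bb.
by move=> ->; lra.
Qed.

Lemma haar_bloch1_pow4 : E (fun M => s1 M ^+ 4) = E (fun M => r M ^+ 4) / 5.
Proof.
pose X := E (fun M => s1 M ^+ 4); pose Y := E (fun M => s1 M ^+ 2 * s2 M ^+ 2).
have X2 : E (fun M => s2 M ^+ 4) = X.
  have := @haar_bloch_cycle (fun _ s _ _ => s ^+ 2).
  rewrite /X => c; transitivity (E (fun M => (s2 M ^+ 2) ^+ 2)).
    by apply: (haarE_eq HU) => M _; rewrite -exprM.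
  by rewrite -c; [apply: (haarE_eq HU) => M _; rewrite -exprM | bb].
have X3 : E (fun M => s3 M ^+ 4) = X.
  have := @haar_bloch_cycle (fun _ _ s _ => s ^+ 2).
  rewrite -X2 => c; transitivity (E (fun M => (s3 M ^+ 2) ^+ 2)).
    by apply: (haarE_eq HU) => M _; rewrite -exprM.
  by rewrite -c; [apply: (haarE_eq HU) => M _; rewrite -exprM | bb].
have Y2 : E (fun M => s2 M ^+ 2 * s3 M ^+ 2) = Y.
  by apply/esym/(@haar_bloch_cycle (fun _ s t _ => s * t)); bb.
have Y3 : E (fun M => s3 M ^+ 2 * s1 M ^+ 2) = Y.
  by rewrite -Y2; apply/esym/(@haar_bloch_cycle (fun _ _ s t => s * t)); bb.
(* Write c = 7/25 and s = 24/25. Adding the cases e = 1 and e = -1 cancels the last term and leaves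
   X = (c^4 + s^4) X + 6 c^2 s^2 Y, that is X = 3 Y because c^2 + s^2 = 1. *)
have rot (e : R) : e ^+ 2 = 1 -> X = (7 / 25) ^+ 4 * X + (6 * (7 / 25) ^+ 2 * (24 / 25) ^+ 2 * Y
    + ((24 / 25) ^+ 4 * X + e * E (fun M => 4 * (7 / 25) * (24 / 25) * s1 M * s2 M *
      ((7 / 25) ^+ 2 * s1 M ^+ 2 + (24 / 25) ^+ 2 * s2 M ^+ 2)))).
  move=> e1; rewrite -{3}X2 {1 2}/X /Y -!(haarEZ HU); try by bb.
  rewrite (haar_bloch_rotate e1) -!(haarED HU); try by bb.
  apply: (haarE_eq HU) => M _.
  have e3 : e ^+ 3 = e by rewrite exprS e1 mulr1.
  have e4 : e ^+ 4 = 1 by rewrite (exprM e 2 2) e1 expr1n.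
  move: (7 / 25) (24 / 25) (s1 M) (s2 M) => c s u v.
  transitivity (c ^+ 4 * u ^+ 4 + e ^+ 2 * (6 * c ^+ 2 * s ^+ 2 * (u ^+ 2 * v ^+ 2))
    + e ^+ 4 * s ^+ 4 * v ^+ 4 + e * (4 * c ^+ 3 * s * u ^+ 3 * v)
     + e ^+ 3 * (4 * c * s ^+ 3 * u * v ^+ 3)); first by ring.
  by rewrite e1 e3 e4; ring.
(* This is the square of s1^2 + s2^2 + s3^2 = r^2; with X = 3 Y the right side becomes 5 X. *)
have r4 : E (fun M => r M ^+ 4) = 3 * X + 6 * Y.
  transitivity (E (fun M => s1 M ^+ 4) + (E (fun M => s2 M ^+ 4) + (E (fun M => s3 M ^+ 4)
    + (2 * E (fun M => s1 M ^+ 2 * s2 M ^+ 2) + (2 * E (fun M => s2 M ^+ 2 * s3 M ^+ 2)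
     + 2 * E (fun M => s3 M ^+ 2 * s1 M ^+ 2)))))); last by rewrite X2 X3 Y2 Y3 -/X -/Y; ring.
  rewrite -!(haarEZ HU); try by bb.
  rewrite -!(haarED HU); try by bb.
  apply: (haarE_eq HU) => M _; rewrite (exprM _ 2 2) -bloch_norm; ring.
have N1 : (-1) ^+ 2 = 1 :> R by ring.
rewrite r4 -/X; move: (rot 1 (expr1n _ _)) (rot (-1) N1).
clearbody X Y; move: (E _) => T; lra.
Qed.

(** Since p(x) = (r + s1) / 2 and p(y) = (r - s1) / 2, every moment here is a rational multiple of
    one expectation of a power of r, and the ratios follow. *)
Lemma haar_pair_moments :
  [/\ E (fun M => p M y) = E (fun M => p M x),
      E (fun M => p M x * p M y) = E (fun M => p M x ^+ 2) / 2,
      E (fun M => p M x ^+ 2 * p M y) = E (fun M => p M x ^+ 3) / 3,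
      E (fun M => p M x ^+ 3 * p M y) = E (fun M => p M x ^+ 4) / 4
    & E (fun M => p M x ^+ 2 * p M y ^+ 2) = E (fun M => p M x ^+ 4) / 6].
Proof.
have px M : p M x = (r M + s1 M) / 2 by rewrite /pU /bloch0 /bloch1; field.
have py M : p M y = (r M - s1 M) / 2 by rewrite /pU /bloch0 /bloch1; field.
have sym (F : R -> R -> R) : bounded_borel (fun M => F (p M x) (p M y)) ->
    E (fun M => F (p M x) (p M y)) = E (fun M => F (p M y) (p M x)).
  have e M : F (p M x) (p M y) = F ((r M + s1 M) / 2) ((r M - s1 M) / 2) by rewrite -px -py.
  have e' M : F (p M y) (p M x) = F ((r M + - s1 M) / 2) ((r M - - s1 M) / 2).
    by rewrite opprK -px -py.
  rewrite (_ : (fun M => F (p M x) (p M y)) = fun M => F ((r M + s1 M) / 2) ((r M - s1 M) / 2)).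
    move=> /(@haar_bloch_flip (fun r s => F ((r + s) / 2) ((r - s) / 2))) ->.
    by apply: (haarE_eq HU) => M _; rewrite e'.
  by apply/funext => M; rewrite e.
(* Averaging over the swap of x and y leaves only even powers of s1, whose expectations are known.
   The coefficient [c] is nonzero only in degree four, where j = 2. *)
have mom (F : R -> R -> R) j (a b c : R) : bounded_borel (fun M => F (p M x) (p M y)) ->
    bounded_borel (fun M => F (p M y) (p M x)) ->
    (forall r s, F ((r + s) / 2) ((r - s) / 2) + F ((r - s) / 2) ((r + s) / 2) =
       a * r ^+ j.+2 + (b * (r ^+ j * s ^+ 2) + c * s ^+ 4)) ->
    E (fun M => F (p M x) (p M y)) =
      ((a + b / 3) * E (fun M => r M ^+ j.+2) + c / 5 * E (fun M => r M ^+ 4)) / 2.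
  move=> bF bF' eF.
  have : E (fun M => F (p M x) (p M y)) + E (fun M => F (p M y) (p M x)) =
      a * E (fun M => r M ^+ j.+2) + (b * E (fun M => r M ^+ j * s1 M ^+ 2)
        + c * E (fun M => s1 M ^+ 4)).
    rewrite -!(haarEZ HU); try by bb.
    rewrite -!(haarED HU); try by bb.
    by apply: (haarE_eq HU) => M _; rewrite px py eF.
  rewrite -(sym F bF) haar_bloch1_sqr haar_bloch1_pow4.
  by move: (E _) (E _) (E _) => ? ? ?; lra.
have s20 : E (fun M => p M x ^+ 2) = E (fun M => r M ^+ 2) / 3.
  by rewrite (@mom (fun u _ => u ^+ 2) 0%N (1 / 2) (1 / 2) 0); [field | bb | bb | move=> *; field].
have s11 : E (fun M => p M x * p M y) = E (fun M => r M ^+ 2) / 6.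
  by rewrite (@mom (fun u v => u * v) 0%N (1 / 2) (- (1 / 2)) 0); [field | bb | bb | move=> *; field].
have s30 : E (fun M => p M x ^+ 3) = E (fun M => r M ^+ 3) / 4.
  by rewrite (@mom (fun u _ => u ^+ 3) 1%N (1 / 4) (3 / 4) 0); [field | bb | bb | move=> *; field].
have s21 : E (fun M => p M x ^+ 2 * p M y) = E (fun M => r M ^+ 3) / 12.
  by rewrite (@mom (fun u v => u ^+ 2 * v) 1%N (1 / 4) (- (1 / 4)) 0); [field | bb | bb | move=> *; field].
have s40 : E (fun M => p M x ^+ 4) = E (fun M => r M ^+ 4) / 5.
  by rewrite (@mom (fun u _ => u ^+ 4) 2%N (1 / 8) (6 / 8) (1 / 8)); [field | bb | bb | move=> *; field].
have s31 : E (fun M => p M x ^+ 3 * p M y) = E (fun M => r M ^+ 4) / 20.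
  by rewrite (@mom (fun u v => u ^+ 3 * v) 2%N (1 / 8) 0 (- (1 / 8))); [field | bb | bb | move=> *; field].
have s22 : E (fun M => p M x ^+ 2 * p M y ^+ 2) = E (fun M => r M ^+ 4) / 30.
  by rewrite (@mom (fun u v => u ^+ 2 * v ^+ 2) 2%N (1 / 8) (- (2 / 8)) (1 / 8)); [field | bb | bb | move=> *; field].
split; first by rewrite (sym (fun _ v => v)) //; bb.
- by rewrite s11 s20; field.
- by rewrite s21 s30; field.
- by rewrite s31 s40; field.
- by rewrite s22 s40; field.
Qed.

End Pair.

Local Notation dR := (d%:R : R).

(** Insert the factor sum_y p(y) = 1: the term y = x raises the power, and each of the d - 1 others
    contributes the same fraction 1 / c of it. *)
Lemma haar_sum_others x k c : (forall y, y != x ->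
    E (fun M => p M x ^+ k * p M y) = E (fun M => p M x ^+ k.+1) / c) ->
  E (fun M => p M x ^+ k) = E (fun M => p M x ^+ k.+1) * (1 + (dR - 1) / c).
Proof.
move=> others.
transitivity (\sum_y E (fun M => p M x ^+ k * p M y)).
  rewrite -(haarE_sum HU) => [|y]; last by bounded_borel.
  by apply: (haarE_eq HU) => M uM; rewrite -mulr_sumr pU_sum1 // mulr1.
rewrite (bigD1 x) //= (eq_bigr (fun=> E (fun M => p M x ^+ k.+1) / c)) //.
rewrite sumr_const cardC1 card_ord.
rewrite (_ : (fun M => p M x ^+ k * p M x) = fun M => p M x ^+ k.+1); last first.
  by apply/funext => M; rewrite exprSr.
by rewrite -[_ *+ d.-1]mulr_natr -subn1 natrB //; ring.
Qed.

(** Solved degree by degree, starting from total mass 1. The values k! / (d (d + 1) ... (d + k - 1))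
    are those of a uniform point of the probability simplex. *)
Lemma haar_moments x :
  [/\ E (fun M => p M x ^+ 2) = 2 / (dR * (dR + 1)),
      E (fun M => p M x ^+ 3) = 6 / (dR * (dR + 1) * (dR + 2))
    & E (fun M => p M x ^+ 4) = 24 / (dR * (dR + 1) * (dR + 2) * (dR + 3))].
Proof.
have d0' : 0 < dR by rewrite ltr0n.
have h0 := @haar_sum_others x 0 1; have h1 := @haar_sum_others x 1 2.
have h2 := @haar_sum_others x 2 3; have h3 := @haar_sum_others x 3 4.
have e1 : E (fun M => p M x) = 1 / dR.
  have h : 1 = E (fun M => p M x ^+ 1) * (1 + (dR - 1) / 1).
    rewrite -h0 ?haarE_cst // => y yx; have [e _ _ _ _] := haar_pair_moments yx.
    by rewrite divr1 -[RHS]e; apply: (haarE_eq HU) => M _; rewrite mul1r.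
  rewrite [X in _ = X / _]h (_ : 1 + (dR - 1) / 1 = dR); last by field.
  by rewrite mulfK ?gt_eqF.
have e2 : E (fun M => p M x ^+ 2) = 2 / (dR * (dR + 1)).
  have : E (fun M => p M x ^+ 1) = _ := h1 _.
  rewrite (_ : E (fun M => p M x ^+ 1) = 1 / dR) // => h.
  have {}h : 1 / dR = E (fun M => p M x ^+ 2) * (1 + (dR - 1) / 2).
    by apply: h => y yx; have [_ e _ _ _] := haar_pair_moments yx.
  apply: (@mulIf _ (1 + (dR - 1) / 2)); first by apply: lt0r_neq0; lra.
  by rewrite -h; field; rewrite ?lt0r_neq0 //; lra.
have e3 : E (fun M => p M x ^+ 3) = 6 / (dR * (dR + 1) * (dR + 2)).
  apply: (@mulIf _ (1 + (dR - 1) / 3)); first by apply: lt0r_neq0; lra.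
  rewrite -h2 ?e2; first by field; rewrite ?lt0r_neq0 //; lra.
  by move=> y yx; have [_ _ e _ _] := haar_pair_moments yx.
split => //.
apply: (@mulIf _ (1 + (dR - 1) / 4)); first by apply: lt0r_neq0; lra.
rewrite -h3 ?e3; first by field; rewrite ?lt0r_neq0 //; lra.
by move=> y yx; have [_ _ _ e _] := haar_pair_moments yx.
Qed.

Lemma haar_psum2 : E (fun M => \sum_x p M x ^+ 2) = 2 / (dR + 1).
Proof.
have d0' : 0 < dR by rewrite ltr0n.
rewrite (haarE_sum HU) => [|x]; last by bounded_borel.
rewrite (eq_bigr (fun=> 2 / (dR * (dR + 1)))) => [|x _]; last by case: (haar_moments x).
by rewrite sumr_const card_ord -[_ *+ d]mulr_natr; field; rewrite ?lt0r_neq0 //; lra.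
Qed.

Lemma haar_psum3 : E (fun M => \sum_x p M x ^+ 3) = 6 / ((dR + 1) * (dR + 2)).
Proof.
have d0' : 0 < dR by rewrite ltr0n.
rewrite (haarE_sum HU) => [|x]; last by bounded_borel.
rewrite (eq_bigr (fun=> 6 / (dR * (dR + 1) * (dR + 2)))) => [|x _]; last by case: (haar_moments x).
by rewrite sumr_const card_ord -[_ *+ d]mulr_natr; field; rewrite ?lt0r_neq0 //; lra.
Qed.

(** Each x contributes the diagonal term E[p(x)^4] and d - 1 cross terms, each a sixth of it. *)
Lemma haar_psum2_sqr : E (fun M => (\sum_x p M x ^+ 2) ^+ 2) =
  4 * (dR + 5) / ((dR + 1) * (dR + 2) * (dR + 3)).
Proof.
have d0' : 0 < dR by rewrite ltr0n.
transitivity (\sum_x \sum_y E (fun M => p M x ^+ 2 * p M y ^+ 2)).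
  under eq_bigr => x _.
    rewrite -(haarE_sum HU); last by move=> y; bounded_borel.
    over.
  rewrite -(haarE_sum HU); last by move=> y; bounded_borel.
  apply: (haarE_eq HU) => M _; rewrite expr2 mulr_suml.
  by apply: eq_bigr => x _; rewrite mulr_sumr.
pose A4 := 24 / (dR * (dR + 1) * (dR + 2) * (dR + 3)).
rewrite (eq_bigr (fun=> A4 * (1 + (dR - 1) / 6))) => [|x _]; last first.
  have [_ _ e4] := haar_moments x.
  rewrite (bigD1 x) //= (eq_bigr (fun=> A4 / 6)) => [|y yx]; last first.
    by have [_ _ _ _ ->] := haar_pair_moments yx; rewrite e4.
  rewrite sumr_const cardC1 card_ord.
  rewrite (_ : (fun M => p M x ^+ 2 * p M x ^+ 2) = fun M => p M x ^+ 4); last first.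
    by apply/funext => M; rewrite -exprD.
  by rewrite e4 -/A4 -[_ *+ d.-1]mulr_natr -subn1 natrB //; ring.
rewrite sumr_const card_ord -[_ *+ d]mulr_natr /A4.
by field; rewrite ?lt0r_neq0 //; lra.
Qed.
End HaarMoments.

(** * Large dimension: collisions between two batches *)

Section SplitCollisions.
Variables (R : realFieldType) (T : finType) (p : T -> R).
Hypotheses (p_ge0 : forall a, 0 <= p a) (p_sum1 : \sum_a p a = 1).

Lemma sum_tuple_iidE n (b : pred (seq T)) :
  \sum_(x : n.-tuple T | b x) \prod_(k < n) p (tnth x k) = iidE p n (fun s => (b s)%:R).
Proof.
rewrite -iidE_tuple big_mkcond; apply: eq_bigr => x _.
by case: (b x); rewrite ?mulr1 ?mulr0.
Qed.

Definition split_collisions m (s : seq T) : R := collisions R (take m s) (drop m s).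

(** The centre [c] is arbitrary: in the Haar case deviations are taken from the mean over [U], not
    from the conditional mean given [U], so the fluctuation of [psum p 2] is included. *)
Lemma split_collisions_dev m c :
  iidE p (m + m) (fun s => (split_collisions m s - c) ^+ 2) =
  m%:R ^+ 2 * psum p 2 + 2 * m%:R ^+ 2 * (m%:R - 1) * psum p 3
  + m%:R ^+ 2 * (m%:R - 1) ^+ 2 * psum p 2 ^+ 2 - 2 * c * (m%:R ^+ 2 * psum p 2) + c ^+ 2.
Proof.
rewrite -(collisions_sqr p_sum1) -(collisions_mean p_sum1) iidE_cat.
rewrite -[X in _ = _ + X](iidE_cst p_sum1 m) -mulNr -iidEZ -!iidED.
apply: eq_size_iidE => s ss.
rewrite -[X in _ = _ + X](iidE_cst p_sum1 m) -iidEZ -!iidED.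
apply: eq_iidE => t; rewrite /split_collisions take_size_cat // drop_size_cat //; ring.
Qed.

End SplitCollisions.

Lemma bounded_borel_iidE (R : realType) d (hd : (0 < d)%N) m (b : pred (seq 'I_d)) :
  bounded_borel (fun M : 'M[R[i]]_d => iidE (pU hd M) m (fun s => (b s)%:R)).
Proof.
under eq_fun do rewrite -sum_tuple_iidE.
by apply: bounded_borel_sum => z; apply: bounded_borel_prod => k; exact: bounded_borel_pU.
Qed.

Section LargeDimension.
Variable R : realType.

Lemma psum_uniform d k : (0 < d)%N ->
  psum (fun _ : 'I_d => (d%:R : R)^-1) k.+1 = (d%:R ^+ k)^-1.
Proof.
move=> d0; rewrite /psum sumr_const card_ord -[_ *+ d]mulr_natr exprVn exprS.
by rewrite invfM mulrAC mulVf ?pnatr_eq0 -?lt0n // mul1r.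
Qed.

Lemma sum_uniform d : (0 < d)%N -> \sum_(a < d) (d%:R : R)^-1 = 1.
Proof.
by move=> d0; rewrite -[RHS]invr1 -(expr0 d%:R) -psum_uniform.
Qed.

Lemma uniform_test_numeric (D m : R) : 1000 <= D -> 400 * D <= m ^+ 2 ->
  (m ^+ 2 * D^-1 + 2 * m ^+ 2 * (m - 1) * (D ^+ 2)^-1 + m ^+ 2 * (m - 1) ^+ 2 * D^-1 ^+ 2
    - 2 * (m ^+ 2 / D) * (m ^+ 2 * D^-1) + (m ^+ 2 / D) ^+ 2) / (m ^+ 2 / (2 * D)) ^+ 2 <= 1 / 3.
Proof.
move=> D1 mD.
have D0 : 0 < D by lra.
have m0 : 0 < m ^+ 2 by lra.
have D0' : D != 0 by apply: lt0r_neq0.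
have m0' : m != 0 by rewrite -sqrf_eq0; apply: lt0r_neq0.
(* The numerator is exactly m^2 (D - 1) / D^2, and m^2 >= 400 D puts the ratio below 1/100. *)
rewrite [leLHS](_ : _ = 4 * (D - 1) / m ^+ 2); last by field; rewrite D0' m0'.
by rewrite ler_pdivrMr //; lra.
Qed.

Lemma haar_test_numeric (D m c : R) : 1000 <= D -> 0 <= m -> 400 * D <= m ^+ 2 ->
  c = 2 * m ^+ 2 / (D + 1) ->
  (m ^+ 2 * (2 / (D + 1)) + 2 * m ^+ 2 * (m - 1) * (6 / ((D + 1) * (D + 2)))
    + m ^+ 2 * (m - 1) ^+ 2 * (4 * (D + 5) / ((D + 1) * (D + 2) * (D + 3)))
    - 2 * c * (m ^+ 2 * (2 / (D + 1))) + c ^+ 2) / (2 / 5 * m ^+ 2 / D) ^+ 2 <= 1 / 3.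
Proof.
move=> D1 m0 mD cE.
have D0 : 0 < D by lra.
have m600 : 600 <= m.
  rewrite leNgt; apply/negP => h.
  have : m * m <= 600 * 600 by apply: ler_pM; lra.
  by lra.
have m1 : 1 <= m by lra.
have mm0 : 0 < m by lra.
have t1 : 2 / (D + 1) <= 2 / D by rewrite ler_pM2l // lef_pV2 ?posrE; lra.
have t2 : 6 / ((D + 1) * (D + 2)) <= 6 / D ^+ 2.
  by rewrite ler_pM2l // lef_pV2 ?posrE ?exprn_gt0 // ?mulr_gt0; lra.
set B := 4 * (D + 5) / ((D + 1) * (D + 2) * (D + 3)).
have B0 : 0 <= B by rewrite /B divr_ge0 //; [lra | rewrite !mulr_ge0; lra].
(* The left side is the variance of S2 under the Haar measure; the leading terms cancel down to
   order D^-3. *)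
have t3 : B - 4 / (D + 1) ^+ 2 <= 4 / D ^+ 3.
  rewrite [leLHS](_ : _ = 4 * ((D - 1) / ((D + 1) ^+ 2 * (D + 2) * (D + 3)))); last first.
    by rewrite /B; field; rewrite !lt0r_neq0; lra.
  rewrite ler_pM2l // ler_pdivrMr; last by rewrite !mulr_gt0 ?exprn_gt0; lra.
  rewrite mulrC ler_pdivlMr ?exprn_gt0 //.
  rewrite -subr_ge0 [leRHS](_ : _ = 8 * D ^+ 3 + 17 * D ^+ 2 + 17 * D + 6); last by ring.
  by rewrite !addr_ge0 ?mulr_ge0 ?exprn_ge0 //; lra.
rewrite ler_pdivrMr; last by rewrite exprn_gt0 // divr_gt0 // mulr_gt0 // exprn_gt0.
have -> : 1 / 3 * (2 / 5 * m ^+ 2 / D) ^+ 2 = 4 / 75 * (m ^+ 2 / D) ^+ 2.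
  by field; rewrite lt0r_neq0.
apply: (@le_trans _ _ (m ^+ 2 * (2 / D) + 2 * m ^+ 3 * (6 / D ^+ 2) + m ^+ 4 * (4 / D ^+ 3))).
  have h0 : c ^+ 2 - 2 * c * (m ^+ 2 * (2 / (D + 1))) = - (m ^+ 4 * (4 / (D + 1) ^+ 2)).
    by rewrite cE; field; rewrite lt0r_neq0; lra.
  have h1 : m ^+ 2 * (2 / (D + 1)) <= m ^+ 2 * (2 / D) by rewrite ler_wpM2l ?sqr_ge0.
  have h2 : 2 * m ^+ 2 * (m - 1) * (6 / ((D + 1) * (D + 2))) <= 2 * m ^+ 3 * (6 / D ^+ 2).
    apply: ler_pM => //.
    - by apply: mulr_ge0; [apply: mulr_ge0 => //; exact: sqr_ge0 | rewrite subr_ge0].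
    - by rewrite divr_ge0 // mulr_ge0 // addr_ge0 // ltW.
    - by rewrite (exprSr m 2) mulrA ler_pM2l ?gerBl // mulr_gt0 ?exprn_gt0.
  have h3 : m ^+ 2 * (m - 1) ^+ 2 * B <= m ^+ 4 * B.
    apply: ler_wpM2r => //; rewrite (exprD m 2 2).
    by apply: ler_wpM2l; [exact: sqr_ge0 | rewrite lerXn2r ?nnegrE ?subr_ge0 ?gerBl].
  have h4 : m ^+ 4 * (B - 4 / (D + 1) ^+ 2) <= m ^+ 4 * (4 / D ^+ 3).
    by rewrite ler_wpM2l // exprn_ge0.
  move: h0 h1 h2 h3 h4; clear.
  by rewrite [m ^+ 4 * (B - _)]mulrBr; move: (m ^+ 4 * B) (m ^+ 4 * _) (m ^+ 2 * _ * B) (2 * c * _) => *; lra.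
(* In terms of q the sum is 2 q + 12 q^2 / m + 4 q^2 / D. By q >= 400, m >= 600 and D >= 1000 it is
   at most (1/200 + 1/50 + 1/250) q^2, below 4/75 q^2. *)
set q := m ^+ 2 / D.
have q400 : 400 <= q by rewrite /q ler_pdivlMr.
have -> : m ^+ 2 * (2 / D) = 2 * q by rewrite /q; field; rewrite lt0r_neq0.
have -> : 2 * m ^+ 3 * (6 / D ^+ 2) = 12 * q ^+ 2 * m^-1 by rewrite /q; field; rewrite !lt0r_neq0.
have -> : m ^+ 4 * (4 / D ^+ 3) = 4 * q ^+ 2 * D^-1 by rewrite /q; field; rewrite !lt0r_neq0.
have im : 600 / m <= 1 by rewrite ler_pdivrMr // mul1r.
have iD : 1000 / D <= 1 by rewrite ler_pdivrMr // mul1r.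
have q20 : 0 <= q ^+ 2 by exact: sqr_ge0.
have g1 : q ^+ 2 * (600 / m) <= q ^+ 2 * 1 by rewrite ler_wpM2l.
have g2 : q ^+ 2 * (1000 / D) <= q ^+ 2 * 1 by rewrite ler_wpM2l.
have q0 : 0 <= q by apply: divr_ge0; [exact: sqr_ge0 | exact: ltW].
have g3 : 400 * q <= q ^+ 2 by rewrite expr2 ler_wpM2r.
by move: g1 g2 g3 q20; move: (q ^+ 2) (m^-1) (D^-1); clear => *; lra.
Qed.

(** The threshold lies roughly midway between the two means, m^2 / d and 2 m^2 / (d + 1). *)
Definition collision_test d m (s : seq 'I_d) : bool :=
  3 / 2 * (m%:R ^+ 2 / d%:R) < split_collisions R m s.

Lemma collision_test_uniform d m : (1000 <= d)%N -> 400 * (d%:R : R) <= m%:R ^+ 2 ->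
  iidE (fun _ : 'I_d => (d%:R : R)^-1) (m + m)
    (fun s => (collision_test m s)%:R) <= 1 / 3.
Proof.
move=> d1000 hm; have d0 : (0 < d)%N by apply: leq_trans d1000.
have D0 : 0 < d%:R :> R by rewrite ltr0n.
have p0 (a : 'I_d) : 0 <= (d%:R : R)^-1 by rewrite invr_ge0 ler0n.
have m0 : 0 < m%:R ^+ 2 :> R by apply: lt_le_trans hm; rewrite mulr_gt0 ?ltr0n.
have D1000 : 1000 <= d%:R :> R by rewrite ler_nat.
have Dl0 : 0 < m%:R ^+ 2 / (2 * d%:R) :> R by rewrite divr_gt0 // mulr_gt0.
apply: le_trans (chebyshev_iidE (p := fun=> _) (f := split_collisions R m) p0 (c := m%:R ^+ 2 / d%:R) (m + m) Dl0 _) _.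
  move=> s /ltW h; apply: le_trans (ler_norm _).
  rewrite lerBrDr (le_trans _ h) // le_eqVlt; apply/orP; left; apply/eqP.
  by field; rewrite lt0r_neq0.
rewrite (split_collisions_dev (p := fun=> _) (sum_uniform d0)) !psum_uniform // expr1.
exact: uniform_test_numeric.
Qed.

(** Chebyshev's inequality is applied for each fixed [U] with the same centre [c]; the resulting
    polynomial [Q] in the power sums is then averaged over [U]. *)
Lemma collision_test_haar d (hd : (0 < d)%N) m (d0 : measure_display)
    (Omega : measurableType d0) (P : probability Omega R) (U : Omega -> 'M[R[i]]_d) :
  haar_random_unitary P U ->
  (1000 <= d)%N -> 400 * (d%:R : R) <= m%:R ^+ 2 ->
  2 / 3 <= haarE P U (fun M => iidE (pU hd M) (m + m)
    (fun s => (collision_test m s)%:R)).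
Proof.
move=> HU d1000 hm.
have D0 : 0 < d%:R :> R by rewrite ltr0n.
have m0 : 0 < m%:R ^+ 2 :> R by apply: lt_le_trans hm; rewrite mulr_gt0 ?ltr0n.
have D1000 : 1000 <= d%:R :> R by rewrite ler_nat.
pose D : R := d%:R; pose mR : R := m%:R.
pose c := 2 * mR ^+ 2 / (D + 1); pose K := 2 / 5 * mR ^+ 2 / D.
have K0 : 0 < K by rewrite divr_gt0 // mulr_gt0.
(* Threshold plus margin is 19/10 m^2 / D, which is at most 2 m^2 / (D + 1) as soon as D >= 19. *)
have Kc : 3 / 2 * (mR ^+ 2 / D) + K <= c.
  rewrite (_ : _ + K = mR ^+ 2 * (19 / 10 / D)); last by rewrite /K; field; rewrite lt0r_neq0.
  rewrite (_ : c = mR ^+ 2 * (2 / (D + 1))); last by rewrite /c; field; rewrite lt0r_neq0; lra.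
  rewrite ler_pM2l // ler_pdivrMr // mulrAC ler_pdivlMr; last by lra.
  by move: D1000; rewrite -/D; lra.
pose Q (M : 'M[R[i]]_d) := mR ^+ 2 * psum (pU hd M) 2
  + 2 * mR ^+ 2 * (mR - 1) * psum (pU hd M) 3
  + mR ^+ 2 * (mR - 1) ^+ 2 * psum (pU hd M) 2 ^+ 2
  + - (2 * c * mR ^+ 2) * psum (pU hd M) 2 + c ^+ 2.
have b2 : bounded_borel (fun M : 'M[R[i]]_d => psum (pU hd M) 2) by rewrite /psum; bounded_borel.
have b3 : bounded_borel (fun M : 'M[R[i]]_d => psum (pU hd M) 3) by rewrite /psum; bounded_borel.
have bQ : bounded_borel Q by rewrite /Q; bounded_borel.
have EQ : haarE P U Q = mR ^+ 2 * (2 / (D + 1)) + 2 * mR ^+ 2 * (mR - 1) * (6 / ((D + 1) * (D + 2)))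
    + mR ^+ 2 * (mR - 1) ^+ 2 * (4 * (D + 5) / ((D + 1) * (D + 2) * (D + 3)))
    - 2 * c * (mR ^+ 2 * (2 / (D + 1))) + c ^+ 2.
  rewrite /Q !haarED //; try by bounded_borel.
  rewrite !(haarEZ HU) ?haarE_cst; try by bounded_borel.
  rewrite (haar_psum2 HU hd) (haar_psum3 HU hd) (haar_psum2_sqr HU hd) -/D.
  by rewrite -/c; ring.
apply: (@le_trans _ _ (1 + - (K ^+ 2)^-1 * haarE P U Q)).
  have := @haar_test_numeric D mR c D1000 (ler0n _ _) hm erefl.
  by rewrite EQ -/K mulNr [X in 1 - X]mulrC; lra.
rewrite -{1}(haarE_cst P U 1) -(haarEZ HU) // -haarED //; try by bounded_borel.
apply: (haarE_le HU); [by bounded_borel | exact: bounded_borel_iidE |].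
move=> M uM; have p0 := pU_ge0 hd M; have p1 := pU_sum1 hd uM.
have := @chebyshev_iidE _ _ (pU hd M) p0 (m + m) (split_collisions R m)
  (fun s => ~~ collision_test m s) c K K0.
rewrite (split_collisions_dev p1) iidE_neg // => cheb.
rewrite mulNr lerBlDr -lerBlDl mulrC.
apply: le_trans (cheb _) _.
  move=> s; rewrite -leNgt => h; rewrite distrC; apply: le_trans (ler_norm _).
  by rewrite lerBrDl (le_trans _ Kc) // lerD2r.
by rewrite ler_pM2r ?invr_gt0 ?exprn_gt0 // /Q; rewrite le_eqVlt; apply/orP; left; apply/eqP; ring.
Qed.

End LargeDimension.

(** * Small dimension: comparing two counts *)

Section TwoCounts.
Variables (R : realFieldType) (T : finType) (x y : T).
Hypothesis xy : y != x.

Definition count_diff (s : seq T) : R := lsum (fun a => (a == x)%:R - (a == y)%:R) s.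
Definition count_total (s : seq T) : R := lsum (fun a => (a == x)%:R + (a == y)%:R) s.

(** The second clause covers distributions with little mass on x and y, whose difference of counts
    is necessarily small. *)
Definition two_count_test (u v : R) (s : seq T) : bool :=
  (u < `|count_diff s|) || (count_total s < v).

Variable p : T -> R.
Hypotheses (p_ge0 : forall a, 0 <= p a) (p_sum1 : \sum_a p a = 1).

Lemma mean_count_diff : mean p (fun a => (a == x)%:R - (a == y)%:R) = p x - p y.
Proof.
rewrite -[p x](mean_eq p) -[p y](mean_eq p) -sumrB.
by apply: eq_bigr => a _; rewrite mulrBr.
Qed.

Lemma mean_count_total : mean p (fun a => (a == x)%:R + (a == y)%:R) = p x + p y.
Proof.
rewrite -[p x](mean_eq p) -[p y](mean_eq p) -big_split.
by apply: eq_bigr => a _; rewrite mulrDr.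
Qed.

Lemma lsum_variance_le n g : (forall a, g a ^+ 2 <= 1) ->
  iidE p n (fun s => (lsum g s - n%:R * mean p g) ^+ 2) <= n%:R.
Proof.
move=> g1; rewrite (lsum_variance p_sum1) -[leRHS]mulr1 ler_wpM2l //.
rewrite lerBlDr (le_trans _ (_ : 1 <= _)) ?lerDl ?sqr_ge0 // -p_sum1.
by apply: ler_sum => a _; rewrite -[leRHS]mulr1 ler_wpM2l.
Qed.

Lemma count_diff_variance n :
  iidE p n (fun s => (count_diff s - n%:R * (p x - p y)) ^+ 2) <= n%:R.
Proof.
rewrite -mean_count_diff; apply: lsum_variance_le => a.
by case: (a == x); case: (a == y); rewrite ?mulr1n ?mulr0n; lra.
Qed.

Lemma count_total_variance n :
  iidE p n (fun s => (count_total s - n%:R * (p x + p y)) ^+ 2) <= n%:R.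
Proof.
rewrite -mean_count_total; apply: lsum_variance_le => a.
have [->|_] := eqVneq a x; first by rewrite eq_sym (negPf xy) mulr1n mulr0n; lra.
by case: (a == y); rewrite ?mulr1n ?mulr0n; lra.
Qed.

Lemma chebyshev_variance n f (b : pred (seq T)) (c K : R) : 0 < n%:R :> R -> 0 < K ->
  iidE p n (fun s => (f s - c) ^+ 2) <= n%:R ->
  (forall s, b s -> n%:R * K <= `|f s - c|) ->
  iidE p n (fun s => (b s)%:R) <= (n%:R * K ^+ 2)^-1.
Proof.
move=> n0 K0 hv hb.
apply: le_trans (chebyshev_iidE p_ge0 n (mulr_gt0 n0 K0) hb) _.
rewrite ler_pdivrMr ?exprn_gt0 ?mulr_gt0 // (le_trans hv) // le_eqVlt.
by apply/orP; left; apply/eqP; field; rewrite !lt0r_neq0.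
Qed.

(** A wrong answer keeps the observed difference within n e while its mean is at least 2 n e in
    modulus, a deviation of at least n e. *)
Lemma two_count_test_unequal n (e v : R) : 0 < n%:R :> R -> 0 < e -> 2 * e <= `|p x - p y| ->
  iidE p n (fun s => (~~ two_count_test (n%:R * e) v s)%:R) <= (n%:R * e ^+ 2)^-1.
Proof.
move=> n0 e0 h; apply: (chebyshev_variance n0 e0 (count_diff_variance n)) => s.
rewrite negb_or -leNgt => /andP[h1 _].
have : n%:R * (2 * e) <= `|n%:R * (p x - p y)|.
  by rewrite normrM ger0_norm ?ler_pM2l // ltW.
have := ler_normB (n%:R * (p x - p y) - count_diff s) (- count_diff s).
rewrite opprK subrK normrN distrC; lra.
Qed.

Lemma two_count_test_light n (u v w : R) : 0 < n%:R :> R -> 0 < w -> v = n%:R * (2 * w) ->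
  p x + p y <= w ->
  iidE p n (fun s => (~~ two_count_test u v s)%:R) <= (n%:R * w ^+ 2)^-1.
Proof.
move=> n0 w0 vE h; apply: (chebyshev_variance n0 w0 (count_total_variance n)) => s.
rewrite negb_or -!leNgt => /andP[_ h1]; apply: le_trans (ler_norm _).
have : n%:R * (p x + p y) <= n%:R * w by rewrite ler_pM2l.
by move: h1; rewrite vE; lra.
Qed.

(** A union bound over the two clauses; the total count has mean 2 n w, twice its threshold. *)
Lemma two_count_test_equal n (e w : R) : 0 < n%:R :> R -> 0 < e -> 0 < w -> p x = p y ->
  p x = w ->
  iidE p n (fun s => (two_count_test (n%:R * e) (n%:R * w) s)%:R) <=
    (n%:R * e ^+ 2)^-1 + (n%:R * w ^+ 2)^-1.
Proof.
move=> n0 e0 w0 pxy pxw.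
apply: (@le_trans _ _ (iidE p n (fun s => (n%:R * e < `|count_diff s|)%R%:R)
    + iidE p n (fun s => (count_total s < n%:R * w)%R%:R))).
  rewrite -iidED; apply: le_iidE => // s; rewrite /two_count_test.
  by case: (_ < `|_|); case: (count_total s < _); rewrite /= ?mulr1n ?mulr0n ?addr0 ?add0r // lerDl.
apply: lerD.
  apply: (chebyshev_variance n0 e0 (count_diff_variance n)) => s /ltW.
  by rewrite -pxy subrr mulr0 subr0.
apply: (chebyshev_variance n0 w0 (count_total_variance n)) => s /ltW h.
rewrite distrC; apply: le_trans (ler_norm _).
by rewrite -pxy pxw; move: h; lra.
Qed.

End TwoCounts.

Section SmallDimension.
Variable R : realType.

(** Divided differences bound B + C (t1 + t2) by 2 e and then C by 4 e; back substitution with |t|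
    <= 3 gives 26 = 2 + 24 and 115 = 1 + 78 + 36. *)
Lemma quadratic_coef_bounds (A B C e t1 t2 t3 : R) :
  1 <= `|t1 - t2| -> 1 <= `|t1 - t3| -> 1 <= `|t2 - t3| ->
  `|t1| <= 3 -> `|t2| <= 3 -> `|t3| <= 3 ->
  `|A + B * t1 + C * t1 ^+ 2| <= e -> `|A + B * t2 + C * t2 ^+ 2| <= e ->
  `|A + B * t3 + C * t3 ^+ 2| <= e ->
  [/\ `|A| <= 115 * e, `|B| <= 26 * e & `|C| <= 4 * e].
Proof.
move=> h12 h13 h23 k1 k2 k3 q1 q2 q3.
have div (k z c : R) : 1 <= `|k| -> `|k * z| <= c -> `|z| <= c.
  by move=> hk; apply: le_trans; rewrite normrM ler_peMl.
have d12 : `|B + C * (t1 + t2)| <= 2 * e.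
  apply: (div (t1 - t2)) => //.
  rewrite (_ : _ * _ = (A + B * t1 + C * t1 ^+ 2) - (A + B * t2 + C * t2 ^+ 2)); last by ring.
  by rewrite (le_trans (ler_normB _ _)) //; lra.
have d13 : `|B + C * (t1 + t3)| <= 2 * e.
  apply: (div (t1 - t3)) => //.
  rewrite (_ : _ * _ = (A + B * t1 + C * t1 ^+ 2) - (A + B * t3 + C * t3 ^+ 2)); last by ring.
  by rewrite (le_trans (ler_normB _ _)) //; lra.
have hC : `|C| <= 4 * e.
  apply: (div (t2 - t3)) => //.
  rewrite (_ : _ * _ = (B + C * (t1 + t2)) - (B + C * (t1 + t3))); last by ring.
  by rewrite (le_trans (ler_normB _ _)) //; lra.
have hB : `|B| <= 26 * e.
  have : `|C * (t1 + t2)| <= 4 * e * 6.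
    by rewrite normrM ler_pM // (le_trans (ler_normD _ _)) //; lra.
  have := ler_normB (B + C * (t1 + t2)) (C * (t1 + t2)); rewrite addrK; lra.
have hA : `|A| <= 115 * e; last by [].
have b1 : `|B * t1| <= 26 * e * 3 by rewrite normrM ler_pM.
have c1 : `|C * t1 ^+ 2| <= 4 * e * 9.
  rewrite normrM ler_pM // normrX (_ : 9 = 3 ^+ 2); last by ring.
  by rewrite lerXn2r ?nnegrE.
have := ler_normB (A + B * t1 + C * t1 ^+ 2) (B * t1 + C * t1 ^+ 2).
have := ler_normD (B * t1) (C * t1 ^+ 2).
have -> : A + B * t1 + C * t1 ^+ 2 - (B * t1 + C * t1 ^+ 2) = A by ring.
by lra.
Qed.

Definition node (t : 'I_7) : R := t%:R - 3.

Lemma node_sep t s : t != s -> 1 <= `|node t - node s|.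
Proof.
rewrite /node -val_eqE => ts; rewrite opprB addrA subrK.
have sep (m n : nat) : (m < n)%N -> 1 <= `|n%:R - m%:R : R|.
  by move=> mn; apply: le_trans (ler_norm _); rewrite lerBrDr addrC natr1 ler_nat.
by have [/sep|/sep|/eqP] := ltngtP t s; [rewrite distrC | | rewrite (negPf ts)].
Qed.

Lemma node_le3 t : `|node t| <= 3.
Proof.
rewrite /node ler_norml lerBrDr lerBlDr.
have : (t <= 6)%N by rewrite -ltnS.
rewrite -(ler_nat R) => h; have : 0 <= t%:R :> R by exact: ler0n.
by move: h; lra.
Qed.

(* The unit complex numbers (1 + i t)^2 / (1 + t^2), scaled by 3/5: they put the
   rotated first axis on a small circle of the sphere, which no plane through the
   origin meets in more than two points.  Clearing the denominator 1 + t^2, the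
   rotated first coordinate is a quadratic polynomial in t. *)
Definition node_phase (t : 'I_7) : R[i] := Complex
  (3 / 5 * ((1 - node t ^+ 2) / (1 + node t ^+ 2)))
  (3 / 5 * (2 * node t / (1 + node t ^+ 2))).
Definition node_su2 d (x y : 'I_d) t := su2 x y (Complex (4 / 5) 0) (node_phase t).

Lemma node_su2_unitary d (x y : 'I_d) t : y != x -> unitary (node_su2 x y t).
Proof.
move=> xy; apply: su2_unitary => //=.
have : 0 <= node t ^+ 2 by exact: sqr_ge0.
by move=> h; field; rewrite lt0r_neq0 //; lra.
Qed.

Section Nodes.
Variables (d : nat) (x y : 'I_d) (xy : y != x) (M : 'M[R[i]]_d) (j : 'I_d).
Local Notation r := (bloch0 x y (fun i => M i j)).
Local Notation s1 := (bloch1 x y (fun i => M i j)).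
Local Notation s2 := (bloch2 x y (fun i => M i j)).
Local Notation s3 := (bloch3 x y (fun i => M i j)).

Lemma node_su2_bloch0 t : bloch0 x y (fun i => (node_su2 x y t *m M) i j) = r.
Proof.
apply: su2_bloch0 => //=.
have : 0 <= node t ^+ 2 by exact: sqr_ge0.
by move=> h; field; rewrite lt0r_neq0 //; lra.
Qed.

Lemma node_su2_bloch1 t : (1 + node t ^+ 2) * bloch1 x y (fun i => (node_su2 x y t *m M) i j) =
  (7 / 25 * s1 + 24 / 25 * s2) + (48 / 25 * s3) * node t + (7 / 25 * s1 - 24 / 25 * s2) * node t ^+ 2.
Proof.
rewrite su2_bloch1 //=.
have h : 0 <= node t ^+ 2 by exact: sqr_ge0.
by field; rewrite lt0r_neq0 //; lra.
Qed.

(** A quadratic in t that is small at three separated nodes has small coefficients, and these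
    determine the Bloch vector. The factor 10 bounds 1 + t^2 for |t| <= 3. *)
Lemma node_three_bad (e : R) t1 t2 t3 : t1 != t2 -> t1 != t3 -> t2 != t3 ->
  (forall t, t \in [:: t1; t2; t3] ->
    `|bloch1 x y (fun i => (node_su2 x y t *m M) i j)| <= e) ->
  r ^+ 2 <= (230 * (10 * e)) ^+ 2.
Proof.
move=> h12 h13 h23 bad.
have q t : t \in [:: t1; t2; t3] -> `|(7 / 25 * s1 + 24 / 25 * s2) + (48 / 25 * s3) * node t
    + (7 / 25 * s1 - 24 / 25 * s2) * node t ^+ 2| <= 10 * e.
  move=> /bad bt; rewrite -node_su2_bloch1 normrM ler_pM //.
  have h0 : 0 <= node t ^+ 2 by exact: sqr_ge0.
  rewrite ger0_norm; last by lra.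
  rewrite (_ : 10 = 1 + 3 ^+ 2); last by ring.
  by rewrite lerD2l -[leLHS]real_normK ?num_real // lerXn2r ?nnegrE // node_le3.
have := quadratic_coef_bounds (node_sep h12) (node_sep h13) (node_sep h23)
  (node_le3 t1) (node_le3 t2) (node_le3 t3) (q t1 _) (q t2 _) (q t3 _).
move: (10 * e) => f; rewrite !inE !eqxx ?orbT => /(_ isT isT isT) [hA hB hC].
have f0 : 0 <= f by have := normr_ge0 (48 / 25 * s3); lra.
have sq (u k : R) : `|u| <= k -> u ^+ 2 <= k ^+ 2.
  move=> h; rewrite -[leLHS]real_normK ?num_real // lerXn2r ?nnegrE //.
  exact: le_trans h.
(* Solving A + C = 14/25 s1, A - C = 48/25 s2 and B = 48/25 s3 gives the constants 213, 62 and 14,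
   whose squares sum to less than 230^2. *)
have e1 : s1 ^+ 2 <= (213 * f) ^+ 2.
  by apply: sq; move: hA hC; rewrite !ler_norml => /andP[? ?] /andP[? ?]; apply/andP; split; lra.
have e2 : s2 ^+ 2 <= (62 * f) ^+ 2.
  by apply: sq; move: hA hC; rewrite !ler_norml => /andP[? ?] /andP[? ?]; apply/andP; split; lra.
have e3 : s3 ^+ 2 <= (14 * f) ^+ 2.
  by apply: sq; move: hB; rewrite !ler_norml => /andP[? ?]; apply/andP; split; lra.
rewrite -bloch_norm; have : 0 <= f ^+ 2 by exact: sqr_ge0.
move: e1 e2 e3; rewrite !exprMn; move: (s1 ^+ 2) (s2 ^+ 2) (s3 ^+ 2) (f ^+ 2); clear => *; lra.
Qed.

End Nodes.
End SmallDimension.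

Lemma invr_le15 (R : realFieldType) (u : R) : 15 <= u -> u^-1 <= 1 / 15.
Proof. by move=> h; rewrite div1r lef_pV2 ?posrE //; lra. Qed.

Section TwoCountHaar.
Variables (R : realType) (d : nat) (hd : (0 < d)%N) (x y : 'I_d) (xy : y != x).
Variables (n : nat) (e w : R).
Hypotheses (e0 : 0 < e) (w0 : 0 < w) (ne : 15 <= n%:R * e ^+ 2) (nw : 15 <= n%:R * w ^+ 2).
Hypothesis ew : 4600 * e < w.
Local Notation test := (two_count_test x y (n%:R * e) (n%:R * (2 * w))).

Let n0 : 0 < n%:R :> R.
Proof. by rewrite lt_neqAle ler0n andbT eq_sym; apply/eqP => h; move: ne; rewrite h; lra. Qed.

(** At most two of the seven nodes are bad, and at the other five the test errs with probability at
    most 1/15; five times 14/15 is 14/3, seven times 2/3. If the mass r is at most w, the total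
    count succeeds at all seven nodes. *)
Lemma node_average (M : 'M[R[i]]_d) : unitary M ->
  14 / 3 <= \sum_(t : 'I_7) iidE (pU hd (node_su2 R x y t *m M)) n (fun s => (test s)%:R).
Proof.
move=> uM.
pose V t := node_su2 R x y t *m M.
have uV t : unitary (V t) by apply: unitaryM => //; exact: node_su2_unitary.
have p0 t := pU_ge0 hd (V t); have p1 t := pU_sum1 hd (uV t).
pose bad := [set t | `|pU hd (V t) x - pU hd (V t) y| < 2 * e]%SET.
have ge0 t : 0 <= iidE (pU hd (V t)) n (fun s => (test s)%:R).
  by apply: iidE_ge0 => // s; rewrite ler0n.
have ok t : iidE (pU hd (V t)) n (fun s => (~~ test s)%:R) <= 1 / 15 ->
    14 / 15 <= iidE (pU hd (V t)) n (fun s => (test s)%:R).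
  by rewrite iidE_neg //; lra.
have good t : t \notin bad -> 14 / 15 <= iidE (pU hd (V t)) n (fun s => (test s)%:R).
  rewrite inE -leNgt => h; apply: ok; apply: le_trans (invr_le15 ne).
  exact: two_count_test_unequal.
pose r := bloch0 x y (fun i => M i (idx0 hd)).
have rV t : pU hd (V t) x + pU hd (V t) y = r by exact: node_su2_bloch0.
have [rw|wr] := leP r w.
  apply: (@le_trans _ _ (\sum_(t : 'I_7) (14 / 15 : R))).
    by rewrite sumr_const card_ord -[_ *+ 7]mulr_natr; lra.
  apply: ler_sum => t _; apply: ok; apply: le_trans (invr_le15 nw).
  by apply: two_count_test_light => //; rewrite rV.
have bad2 : (#|bad| <= 2)%N.
  rewrite leqNgt; apply/negP => /card_gt2P [t1 [t2 [t3 [[b1 b2 b3] [h12 h23 h31]]]]].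
  (* Three bad nodes would bound r by 4600 e < w, where 4600 = 230 . 10 . 2, contradicting w < r. *)
  have : r ^+ 2 <= (230 * (10 * (2 * e))) ^+ 2.
    apply: (@node_three_bad _ _ _ _ xy _ _ _ t1 t2 t3) => //; first by rewrite eq_sym.
    move=> t; rewrite !inE => /or3P[] /eqP ->; apply: ltW;
      [move: b1 | move: b2 | move: b3]; by rewrite inE.
  have h0 : 0 <= 230 * (10 * (2 * e)) by rewrite !mulr_ge0 // ltW.
  have hr : 230 * (10 * (2 * e)) < r by apply: lt_trans wr; move: ew; lra.
  by apply/negP; rewrite -ltNge !expr2; apply: ltr_pM.
rewrite (bigID (mem bad)) /= -[leLHS]add0r; apply: lerD; first by apply: sumr_ge0 => t _; exact: ge0.
apply: (@le_trans _ _ (\sum_(t : 'I_7 | t \notin bad) (14 / 15 : R))); last first.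
  by apply: ler_sum => t tb; exact: good.
rewrite sumr_const -[_ *+ _]mulr_natr.
have : (5 <= #|[predC bad]|)%N.
  have h : (#|bad| + #|[predC bad]| = 7)%N by rewrite cardC card_ord.
  by rewrite -(leq_add2l #|bad|) h (leq_add2r 5 _ 2).
rewrite -(ler_nat R) => h.
rewrite (_ : #|_| = #|[predC bad]|); last by apply: eq_card => t; rewrite !inE.
by lra.
Qed.

(** By invariance each rotation leaves the expectation unchanged, so it is a seventh of the expected
    sum over the nodes. *)
Lemma two_count_test_haar (d0 : measure_display)
    (Omega : measurableType d0) (P : probability Omega R) (U : Omega -> 'M[R[i]]_d) :
  haar_random_unitary P U ->
  2 / 3 <= haarE P U (fun M => iidE (pU hd M) n (fun s => (test s)%:R)).
Proof.
move=> HU; set h := fun M => _.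
have bh : bounded_borel h by exact: bounded_borel_iidE.
have bV t : bounded_borel (fun M => h (node_su2 R x y t *m M)).
  by apply: bounded_borel_mulmxl => //; exact: node_su2_unitary.
have : 14 / 3 <= haarE P U (fun M => \sum_(t : 'I_7) h (node_su2 R x y t *m M)).
  rewrite -(haarE_cst P U (14 / 3)); apply: (haarE_le HU).
  - exact: bounded_borel_cst.
  - exact: bounded_borel_sum.
  - exact: node_average.
rewrite (haarE_sum HU) // (eq_bigr (fun=> haarE P U h)) => [|t _]; last first.
  by rewrite -(haarE_invariant HU) //; exact: node_su2_unitary.
by rewrite sumr_const card_ord -[_ *+ 7]mulr_natr; lra.
Qed.

End TwoCountHaar.

(** * Choice of the number of samples and conclusion *)

Lemma exists_sqr_ge (R : realType) d : (0 < d)%N ->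
  exists k : nat, d%:R <= k%:R ^+ 2 :> R /\ k%:R <= 2 * Num.sqrt d%:R :> R.
Proof.
move=> d0; have d1 : 1 <= d%:R :> R by rewrite ler1n.
have s1 : 1 <= Num.sqrt d%:R :> R by rewrite -[leLHS]sqrtr1 ler_sqrt // (lt_le_trans ltr01).
have s0 : 0 <= Num.sqrt d%:R :> R by exact: sqrtr_ge0.
exists (Num.truncn (Num.sqrt (d%:R : R))).+1.
have /andP[h1 h2] := Num.Theory.truncn_itv s0; split.
  rewrite -[leLHS]sqr_sqrtr; last by rewrite ler0n.
  by rewrite lerXn2r ?nnegrE ?ler0n // ltW.
by rewrite -natr1; lra.
Qed.

Definition distinguishes (R : realType) d (hd : (0 < d)%N) N (b : pred (seq 'I_d)) :=
  iidE (fun _ : 'I_d => (d%:R : R)^-1) N (fun s => (b s)%:R) <= 1 / 3 /\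
  forall (d0 : measure_display) (Omega : measurableType d0)
      (P : probability Omega R) (U : Omega -> 'M[R[i]]_d),
    haar_random_unitary P U ->
    2 / 3 <= haarE P U (fun M => iidE (pU hd M) N (fun s => (b s)%:R)).

Lemma collision_test_distinguishes (R : realType) d (hd : (0 < d)%N) : (1000 <= d)%N ->
  exists N, N%:R <= 80 * Num.sqrt (d%:R : R) /\ exists b, distinguishes R hd N b.
Proof.
move=> d1000; have [k [hk1 hk2]] := exists_sqr_ge R hd.
(* Batches of size m = 20 k have m^2 >= 400 d, and N = 2 m = 40 k <= 80 sqrt d. *)
have hm : 400 * (d%:R : R) <= (20 * k)%:R ^+ 2.
  by move: hk1; rewrite natrM exprMn; clear; lra.
exists (20 * k + 20 * k)%N; split; first by move: hk2; rewrite natrD natrM; clear; lra.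
exists (collision_test R (20 * k)); split; first exact: collision_test_uniform.
by move=> *; exact: collision_test_haar.
Qed.

Lemma two_count_test_distinguishes (R : realType) :
  exists L : nat, forall d (hd : (2 <= d)%N),
  exists b, distinguishes R (ltnW hd) (L * d ^ 2) b.
Proof.
(* With e = 1 / (K d) and w = 1 / (2 d), the condition 4600 e < w reads K > 4600 . 2. Then L >= 15
   K^2 makes N e^2 = L / K^2 at least 15. *)
have [K [K4 hK]] : exists K : R, 4 <= K /\ 4600 * 2 < K.
  by exists (4600 * 2 + 4); split; lra.
have K0 : 0 < K by apply: lt_le_trans K4; rewrite ltr0n.
have [L hL] : exists L : nat, 15 * K ^+ 2 <= L%:R.
  by exists (Num.truncn (15 * K ^+ 2)).+1; rewrite ltW // truncnS_gt.
have hL4 : 15 * 4 <= L%:R :> R.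
  apply: le_trans hL; rewrite ler_pM2l ?ltr0n // (le_trans K4) //.
  by rewrite expr2 ler_peMl ?(le_trans _ K4) ?ler1n // ltW.
exists L => d hd; have d0 : (0 < d)%N := ltnW hd.
have D0 : 0 < d%:R :> R by rewrite ltr0n.
pose x := idx0 d0; pose y := Ordinal hd.
have xy : y != x by [].
(* The mass bound w is a quarter of the uniform mass 2 / d of the pair, and the count threshold 2 w
   N = N / d is half the uniform mean. *)
pose e : R := (K * d%:R)^-1; pose w : R := (2 * d%:R)^-1.
pose N := (L * d ^ 2)%N.
have e0 : 0 < e by rewrite invr_gt0 mulr_gt0.
have w0 : 0 < w by rewrite invr_gt0 mulr_gt0.
have w2 : 0 < 2 * w by rewrite mulr_gt0.
have NE : N%:R = L%:R * d%:R ^+ 2 :> R by rewrite natrM natrX.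
have L0 : 0 < L%:R :> R by apply: lt_le_trans hL4; rewrite mulr_gt0 ?ltr0n.
have N0 : 0 < N%:R :> R by rewrite NE mulr_gt0 ?exprn_gt0.
have ne : 15 <= N%:R * e ^+ 2.
  rewrite (_ : _ * _ = L%:R / K ^+ 2); first by rewrite ler_pdivlMr ?exprn_gt0.
  by rewrite NE /e; field; rewrite !lt0r_neq0.
have nw : 15 <= N%:R * w ^+ 2.
  rewrite (_ : _ * _ = L%:R / 4); first by rewrite ler_pdivlMr ?ltr0n.
  by rewrite NE /w; field; rewrite !lt0r_neq0.
have ew : 4600 * e < w.
  rewrite /e /w !invfM mulrA ltr_pM2r ?invr_gt0 // ltr_pdivrMr //.
  by rewrite mulrC ltr_pdivlMr ?ltr0n.
exists (two_count_test x y (N%:R * e) (N%:R * (2 * w))); split; last first.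
  by move=> *; exact: two_count_test_haar.
(* Here 2 w takes the place of w, since p(x) = 1 / d = 2 w for the uniform distribution. *)
apply: le_trans (two_count_test_equal (p := fun=> d%:R^-1) xy _ (sum_uniform R d0) N0 e0 w2 _ _) _ => //.
  by rewrite /w; field; rewrite lt0r_neq0.
have nw2 : 15 <= N%:R * (2 * w) ^+ 2.
  apply: (le_trans nw); rewrite ler_pM2l // lerXn2r ?nnegrE ?ltW //.
  by rewrite ltr_pMl ?ltr1n.
by apply: le_trans (lerD (invr_le15 ne) (invr_le15 nw2)) _; clear; lra.
Qed.

(* A (deterministic) test T reads N samples and outputs true = "H1", false = "H0".
   Success probability >= 2/3 under both hypotheses; N <= C sqrt d with C independent of d. *)
Theorem theorem3 (R : realType) :
  exists C : R, 0 < C /\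
  forall (d : nat) (hd : (2 <= d)%N),
  exists N : nat, N%:R <= C * Num.sqrt (d%:R : R) /\
  exists T : N.-tuple 'I_d -> bool,
    (* H0: i.i.d. uniform samples; probability of answering "H0" *)
    (2 / 3 <= \sum_(x : N.-tuple 'I_d | ~~ T x) \prod_(k < N) (d%:R : R)^-1) /\
    (* H1: U Haar-random (drawn once), then i.i.d. samples from p_U;
       probability of answering "H1", averaged over U *)
    (forall (d0 : measure_display) (Omega : measurableType d0)
            (P : probability Omega R) (U : Omega -> 'M[R[i]]_d),
       haar_random_unitary P U ->
       ((2 / 3)%:E <=
        \int[P]_w (\sum_(x : N.-tuple 'I_d | T x)
                     \prod_(k < N) pU (ltnW hd) (U w) (tnth x k))%:E)%E).
Proof.
have [L small] := two_count_test_distinguishes R.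
(* For d < 1000 the sample size L d^2 is at most the constant L Q, absorbed by C because sqrt d >=
   1. *)
have [Q Q1000] : exists Q : R, 1000 ^+ 2 <= Q by exists (1000 ^+ 2).
have Q0 : 0 <= Q by apply: le_trans Q1000; rewrite exprn_ge0 ?ler0n.
have LQ0 : 0 <= L%:R * Q by rewrite mulr_ge0 ?ler0n.
exists (80 + L%:R * Q); split; first by rewrite ltr_wpDr ?ltr0n.
move=> d hd; have d0 : (0 < d)%N := ltnW hd.
have sd1 : 1 <= Num.sqrt d%:R :> R.
  by rewrite -[leLHS]sqrtr1 ler_sqrt ?ler1n // ltr0n.
suff [N [hN [b [b0 b1]]]] : exists N : nat,
    N%:R <= (80 + L%:R * Q) * Num.sqrt (d%:R : R) /\ exists b, distinguishes R (ltnW hd) N b.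
  exists N; split => //; exists (fun x => b x); split.
    rewrite (sum_tuple_iidE (fun _ : 'I_d => (d%:R : R)^-1) N (fun s => ~~ b s)).
    by rewrite iidE_neg ?sum_uniform //; move: b0; clear; lra.
  move=> d1 Omega P U HU.
  under eq_integral do rewrite (sum_tuple_iidE _ N b).
  rewrite (haar_integralE HU (bounded_borel_iidE R (ltnW hd) N b)) lee_fin.
  exact: b1.
have [d1000|d1000] := leqP 1000 d.
  have [N [hN hb]] := collision_test_distinguishes R (ltnW hd) d1000.
  exists N; split => //; apply: le_trans hN _.
  by rewrite ler_wpM2r ?sqrtr_ge0 ?lerDl.
exists (L * d ^ 2)%N; split; last exact: small.
rewrite natrM natrX; apply: (@le_trans _ _ (L%:R * Q * 1)).
  rewrite mulr1 ler_wpM2l ?ler0n //; apply: le_trans Q1000.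
  by rewrite lerXn2r ?nnegrE ?ler0n // ler_nat ltnW.
by apply: ler_pM; rewrite ?ler01 // lerDr ler0n.
Qed.
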